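(* Let $R$ be an integral domain with field of fractions $K$, and let $h:R\to[0,\infty)$ be a height function of $\theta$-type for some $\theta:\mathbb N\to\mathbb N$. For all integers $n\ge 1$, $D\ge 1$, $H\ge 1$ there exist constants $c_1=c_1(n,D)$, depending only on $n,D$, and $c_2=c_2(n,D,H,\theta)$, depending only on $n,D,H,\theta$, such that the following holds: if $f_1,\dots,f_s\in R[X_1,\dots,X_n]$ have no common zero in $K^{alg}$, $\deg(f_i)\le D$ and $h(f_i)\le H$ for all $i$, then there exist a nonzero $a\in R$ and $h_1,\dots,h_s\in R[X_1,\dots,X_n]$ such that (i) $a=f_1h_1+\dots+f_sh_s$; (ii) $\deg(h_i)\le c_1$ for all $i$; (iii) $h(a)\le c_2$ and $h(h_i)\le c_2$ for all $i$; (iv) if moreover $R$ is a UFD with the p-property and $h(x)=|x|$ is the absolute value of $R$, then $a$ can be chosen such that $\gcd(a,a_1,\dots,a_m)=1$, where $a_1,\dots,a_m$ are all the elements of $R$ occurring as a coefficient of some $h_i$.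
   Context: A function $h:R\to[0,\infty)$ is a height function of $\theta$-type if for all $x,y\in R$ and $n\in\mathbb N$ with $h(x)\le n$ and $h(y)\le n$ one has $h(x+y)\le\theta(n)$ and $h(xy)\le\theta(n)$. The function $h$ is extended to polynomials by $h\big(\sum_\alpha a_\alpha X^\alpha\big)=\max_\alpha h(a_\alpha)$. $\deg$ denotes total degree; $K^{alg}$ is an algebraic closure of $K$. An absolute value on $R$ is a map $|\cdot|:R\to[0,\infty)$ with $|x|=0$ iff $x=0$, $|xy|=|x||y|$, $|x+y|\le|x|+|y|$. $R$ is a UFD with the p-property if $R$ is a unique factorization domain endowed with an absolute value such that every unit has absolute value $1$, and such that whenever there are primes $p,q$ with $|p|<1<|q|$, there is another prime $r$ not associated to $p$ with $|r|<1$.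
   Formalization: The constant c_2 is allowed to depend also on h(-1), i.e. c_2=c_2(n,D,H,θ,h(-1)), because θ-type does not bound h(-x) and the claim with c_2(n,D,H,θ) alone fails (R=Z, h(x)=x for x≥0, M+|x| for x<0, f_1=X, f_2=X+1); for an absolute value h(-1)=1. *)

(* Defs.v *)
From HB Require Import structures.
From mathcomp Require Import all_boot all_order all_algebra.
From mathcomp Require Import fraction mpoly reals.

Set Implicit Arguments.
Unset Strict Implicit.
Unset Printing Implicit Defensive.

Import Order.TTheory GRing.Theory Num.Theory.

Local Open Scope ring_scope.

Section Heights.
Variables (RR : realType) (R : idomainType).

Definition height_of_type (theta : nat -> nat) (h : R -> RR) : Prop :=
  (forall x, 0 <= h x) /\
  (forall (x y : R) (n : nat), h x <= n%:R -> h y <= n%:R ->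
     h (x + y) <= (theta n)%:R /\ h (x * y) <= (theta n)%:R).

(* The maximum runs over the coefficients that actually occur in [p], so the
   zero polynomial has height 0 and [h 0] plays no role. *)
Definition poly_height (h : R -> RR) (n : nat) (p : {mpoly R[n]}) : RR :=
  \big[Num.max/0]_(m <- msupp p) h p@_m.

End Heights.

(* [msize p] is the total degree plus one, and 0 for [p = 0]; the zero
   polynomial thus gets degree 0 and satisfies every degree bound. *)
Definition total_degree (R : idomainType) (n : nat) (p : {mpoly R[n]}) : nat :=
  (msize p).-1.

(* [iota] presents the algebraically closed field [L] as an algebraic closure
   of the field of fractions of [R]. *)
Definition is_algebraic_closure (R : idomainType) (L : closedFieldType)
    (iota : {rmorphism {fraction R} -> L}) : Prop :=
  forall z : L, algebraicOver iota z.

Definition common_zero (R : idomainType) (L : closedFieldType)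
    (iota : {rmorphism {fraction R} -> L}) (n s : nat)
    (f : 'I_s -> {mpoly R[n]}) (z : 'I_n -> L) : Prop :=
  forall i, (map_mpoly (fun c : R => iota (tofrac c)) (f i)).@[z] = 0.

Section Divisibility.
Variable R : idomainType.

Definition divides (a b : R) : Prop := exists c, b = c * a.

Definition associated (a b : R) : Prop :=
  exists2 u : R, u \is a GRing.unit & b = u * a.

Definition irreducible_elt (p : R) : Prop :=
  [/\ p != 0, p \isn't a GRing.unit &
      forall a b, p = a * b -> a \is a GRing.unit \/ b \is a GRing.unit].

Definition prime_elt (p : R) : Prop :=
  [/\ p != 0, p \isn't a GRing.unit &
      forall a b, divides p (a * b) -> divides p a \/ divides p b].

Definition is_ufd : Prop :=
  (forall x : R, x != 0 -> x \isn't a GRing.unit ->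
     exists2 s : seq R, (forall p, p \in s -> irreducible_elt p) &
       x = \prod_(p <- s) p) /\
  (forall s t : seq R,
     (forall p, p \in s -> irreducible_elt p) ->
     (forall p, p \in t -> irreducible_elt p) ->
     \prod_(p <- s) p = \prod_(p <- t) p ->
     exists t' : seq R,
       [/\ perm_eq t t', size s = size t' &
           forall i, (i < size s)%N -> associated s`_i t'`_i]).

(* Greatest common divisors are only defined up to units: [is_gcd S 1] is the
   meaning of "the gcd of the elements of S is 1". *)
Definition is_gcd (S : R -> Prop) (d : R) : Prop :=
  (forall x, S x -> divides d x) /\
  (forall e, (forall x, S x -> divides e x) -> divides e d).

Variable RR : realType.

Definition is_absolute_value (v : R -> RR) : Prop :=
  [/\ forall x, 0 <= v x,
      forall x, v x = 0 <-> x = 0,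
      forall x y, v (x * y) = v x * v y &
      forall x y, v (x + y) <= v x + v y].

Definition ufd_with_p_property (v : R -> RR) : Prop :=
  [/\ is_ufd,
      is_absolute_value v,
      forall u, u \is a GRing.unit -> v u = 1 &
      forall p q, prime_elt p -> prime_elt q -> v p < 1 -> 1 < v q ->
        exists r, [/\ prime_elt r, ~ associated p r & v r < 1]].

End Divisibility.

(* Main.v *)
Require Import Defs.
From HB Require Import structures.
From mathcomp Require Import all_boot all_order all_algebra.
From mathcomp Require Import perm fraction mpoly boolp reals.
From mathcomp Require Import zify ring.

Set Implicit Arguments.
Unset Strict Implicit.
Unset Printing Implicit Defensive.

Import Order.TTheory GRing.Theory Num.Theory.

Local Open Scope ring_scope.

(* Over an algebraically closed field [L] a Nullstellensatz with a degree bound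
   is proved by induction on the number of variables, for arbitrary sets of
   polynomials of degree at most [d]. A Nagata change of variables makes one
   polynomial [f] monic, up to a constant, in the main variable [T]. Given a
   point [x] of the smaller space, a linear combination [g] of the polynomials
   has no zero in common with [T f] above [x]; the resultant of [T f] and
   [g + T^k (T f)], for a large [k], then lies in the ideal and does not vanish
   at [x]. All such resultants thus have no common zero and a bounded degree.

   The degree bound turns the identity [1 = sum f_i g_i] into a linear system
   over [R] which is solvable over [L], and Cramer's rule gives a solution over
   [R] whose entries are polynomials in the coefficients of the [f_i] of a form
   that depends only on [n] and [D]; this bounds their heights.

   For the last claim, divide by the gcd. This does not increase absolute
   values if all primes have absolute value at least 1, and the bound is trivial
   if none exceeds 1. Otherwise there are two non-associated primes [p] and [r]
   of absolute value less than 1; multiply the reduced solution by a power of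
   [p] and add a power of [r] times a primitive syzygy of two of the [f_i],
   shifted to large degree so that the two sets of coefficients do not mix. *)

(** * Degree filtrations *)

HB.mixin Record isFiltration (A : comNzRingType) (F : nat -> A -> Prop) := {
  filW : forall a b x, (a <= b)%N -> F a x -> F b x;
  fil1 : F 0 1;
  filN : forall a x, F a x -> F a (- x);
  filD : forall a x y, F a x -> F a y -> F a (x + y);
  filM : forall a b x y, F a x -> F b y -> F (a + b)%N (x * y) }.

#[short(type=filtration)]
HB.structure Definition Filtration (A : comNzRingType) :=
  {F of isFiltration A F}.

Section FiltrationTheory.
Variables (A : comNzRingType) (F : filtration A).

Lemma fil0 a : F a 0.
Proof.
apply: (@filW _ F 0) => //; rewrite -(subrr 1).
by apply: filD; [|apply: filN]; apply: fil1.
Qed.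

Lemma fil_sum (I : Type) (r : seq I) (P : pred I) (E : I -> A) a :
  (forall i, P i -> F a (E i)) -> F a (\sum_(i <- r | P i) E i).
Proof. by move=> FE; elim/big_ind: _ => //; [exact: fil0 | exact: filD]. Qed.

Lemma fil_prod (I : Type) (r : seq I) (P : pred I) (E : I -> A) (d : I -> nat) :
  (forall i, P i -> F (d i) (E i)) ->
  F (\sum_(i <- r | P i) d i)%N (\prod_(i <- r | P i) E i).
Proof.
move=> FE; elim/big_rec2: _ => [|i x a Pi Fx]; first exact: fil1.
by apply: filM => //; apply: FE.
Qed.

Lemma filX a x k : F a x -> F (a * k)%N (x ^+ k).
Proof.
move=> Fx; elim: k => [|k IHk]; first by rewrite muln0; apply: fil1.
by rewrite exprS mulnS; apply: filM.
Qed.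

Lemma filMsign a k x : F a x -> F a ((-1) ^+ k * x).
Proof.
by move=> Fx; rewrite -signr_odd mulr_sign; case: ifP => // _; apply: filN.
Qed.

Lemma fil_det N (M : 'M[A]_N) a :
  (forall i j, F a (M i j)) -> F (N * a)%N (\det M).
Proof.
move=> FM; apply: fil_sum => s _; apply: filMsign.
have -> : (N * a = \sum_(i < N) a)%N by rewrite sum_nat_const card_ord.
exact: fil_prod.
Qed.

Lemma fil_cofactor N (M : 'M[A]_N) a i j :
  (forall i j, F a (M i j)) -> F (N * a)%N (cofactor M i j).
Proof.
move=> FM; apply/filMsign/(@filW _ _ (N.-1 * a)).
  by rewrite leq_mul2r leq_pred orbT.
by apply: fil_det => k l; rewrite !mxE.
Qed.

Lemma fil_mmap (R : nzRingType) n (c : R -> A) (g : 'I_n -> A) a d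
    (p : {mpoly R[n]}) :
    (forall x, F 0 (c x)) -> (forall i, F a (g i)) -> (msize p <= d.+1)%N ->
  F (a * d)%N (mmap c g p).
Proof.
move=> Fc Fg pd; rewrite /mmap big_seq; apply: fil_sum => m mp.
rewrite -[(a * d)%N]add0n; apply: filM => //.
apply: (@filW _ _ (\sum_(i < n) a * m i)); last first.
  by apply: fil_prod => i _; apply: filX.
rewrite -big_distrr /= leq_mul2l -mdegE -ltnS.
by rewrite (leq_trans (msize_mdeg_lt mp) pd) orbT.
Qed.

End FiltrationTheory.

Definition degree_le (R : idomainType) n (d : nat) (p : {mpoly R[n]}) : Prop :=
  (total_degree p <= d)%N.

Lemma degree_leE (R : idomainType) n d (p : {mpoly R[n]}) :
  degree_le d p = (msize p <= d.+1)%N.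
Proof. by rewrite /degree_le /total_degree; case: (msize p). Qed.

Section DegreeFiltration.
Variables (R : idomainType) (n : nat).
Implicit Types p q : {mpoly R[n]}.

Fact degree_leW a b p : (a <= b)%N -> degree_le a p -> degree_le b p.
Proof. by move=> /[swap]; apply: leq_trans. Qed.

Lemma degree_leC d (c : R) : degree_le d (c%:MP : {mpoly R[n]}).
Proof. by rewrite degree_leE msizeC; case: eqP. Qed.

Fact degree_leN a p : degree_le a p -> degree_le a (- p).
Proof. by rewrite !degree_leE msizeN. Qed.

Fact degree_leD a p q : degree_le a p -> degree_le a q -> degree_le a (p + q).
Proof.
rewrite !degree_leE => pa qa.
by rewrite (leq_trans (msizeD_le _ _)) // geq_max pa.
Qed.

Fact degree_leM a b p q :
  degree_le a p -> degree_le b q -> degree_le (a + b) (p * q).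
Proof.
rewrite !degree_leE => pa qb.
have [->|p_nz] := eqVneq p 0; first by rewrite mul0r msize0.
have [->|q_nz] := eqVneq q 0; first by rewrite mulr0 msize0.
by rewrite msizeM //; lia.
Qed.

HB.instance Definition _ := isFiltration.Build {mpoly R[n]} (@degree_le R n)
  degree_leW (degree_leC 0 1) degree_leN degree_leD degree_leM.

Lemma degree_leX m : degree_le (mdeg m) ('X_[m] : {mpoly R[n]}).
Proof. by rewrite degree_leE msizeX. Qed.

Lemma degree_leXn i k : degree_le k ('X_i ^+ k : {mpoly R[n]}).
Proof. by rewrite mpolyXn degree_leE msizeX mdegMn mdeg1 mul1n. Qed.

Lemma degree_leXU i : degree_le 1 ('X_i : {mpoly R[n]}).
Proof. exact: degree_leXn i 1. Qed.

Lemma degree_leZ d c p : degree_le d p -> degree_le d (c *: p).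
Proof. by rewrite !degree_leE; apply: leq_trans (msizeZ_le _ _). Qed.

End DegreeFiltration.

Lemma degree_le_map_mpoly (R S : idomainType) (phi : {rmorphism R -> S}) n d
    (p : {mpoly R[n]}) : degree_le d p -> degree_le d (map_mpoly phi p).
Proof.
rewrite !degree_leE; apply: leq_trans.
rewrite msizeE; apply/bigmax_leqP_seq => m.
rewrite mcoeff_msupp mcoeff_map_mpoly => phi_nz _.
apply: msize_mdeg_lt; rewrite mcoeff_msupp.
by apply: contraNneq phi_nz => ->; apply/eqP/rmorph0.
Qed.

Definition poly_fil (A : comNzRingType) (F : nat -> A -> Prop) (d : nat)
    (P : {poly A}) : Prop :=
  (size P <= d.+1)%N /\ forall i, F d P`_i.

Section PolyFiltration.
Variables (A : comNzRingType) (F : filtration A).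
Implicit Types P Q : {poly A}.

Fact poly_filW a b P : (a <= b)%N -> poly_fil F a P -> poly_fil F b P.
Proof.
move=> ab [sP FP]; split=> [|i]; last exact: filW (FP i).
exact: leq_trans sP _.
Qed.

Lemma poly_filC d x : F d x -> poly_fil F d x%:P.
Proof.
move=> Fx; split=> [|i]; first by rewrite (leq_trans (size_polyC_leq1 _)).
by rewrite coefC; case: eqP => // _; apply: fil0.
Qed.

Fact poly_filN a P : poly_fil F a P -> poly_fil F a (- P).
Proof.
by move=> [sP FP]; split=> [|i]; rewrite ?size_polyN // coefN; apply: filN.
Qed.

Fact poly_filD a P Q : poly_fil F a P -> poly_fil F a Q -> poly_fil F a (P + Q).
Proof.
move=> [sP FP] [sQ FQ]; split=> [|i]; last by rewrite coefD; apply: filD.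
by rewrite (leq_trans (size_polyD _ _)) // geq_max sP.
Qed.

Fact poly_filM a b P Q :
  poly_fil F a P -> poly_fil F b Q -> poly_fil F (a + b) (P * Q).
Proof.
move=> [sP FP] [sQ FQ]; split=> [|i].
  by rewrite (leq_trans (size_polyMleq _ _)) //; lia.
by rewrite coefM; apply: fil_sum => j _; apply: filM.
Qed.

HB.instance Definition _ := isFiltration.Build {poly A} (poly_fil F)
  poly_filW (poly_filC (@fil1 A F)) poly_filN poly_filD poly_filM.

Lemma poly_filXn d : poly_fil F d 'X^d.
Proof.
split=> [|i]; first by rewrite size_polyXn.
rewrite coefXn; apply: (@filW _ _ 0) => //.
by case: eqP => _; [apply: fil1 | apply: fil0].
Qed.

Lemma poly_filX : poly_fil F 1 'X.
Proof. exact: poly_filXn 1. Qed.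

End PolyFiltration.

(** * Ideals generated with bounded multipliers *)

Inductive bounded_ideal (A : comNzRingType) (F : nat -> A -> Prop)
    (S : A -> Prop) (d : nat) : A -> Prop :=
| BoundedIdeal0 : bounded_ideal F S d 0
| BoundedIdealS f g x : S f -> F d g -> bounded_ideal F S d x ->
    bounded_ideal F S d (f * g + x).

Section BoundedIdeal.
Variables (A : comNzRingType) (F : filtration A) (S : A -> Prop).

Lemma bounded_ideal_mem d f g : S f -> F d g -> bounded_ideal F S d (f * g).
Proof.
by move=> Sf Fg; rewrite -[f * g]addr0; constructor=> //; constructor.
Qed.

Lemma bounded_idealD d x y :
  bounded_ideal F S d x -> bounded_ideal F S d y -> bounded_ideal F S d (x + y).
Proof.
move=> Sx Sy; elim: Sx => [|f g z Sf Fg _ IHz]; first by rewrite add0r.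
by rewrite -addrA; constructor.
Qed.

Lemma bounded_idealMl d e x y :
  F e y -> bounded_ideal F S d x -> bounded_ideal F S (e + d) (y * x).
Proof.
move=> Fy; elim=> [|f g z Sf Fg _ IHz]; first by rewrite mulr0; constructor.
by rewrite mulrDr mulrCA; constructor => //; apply: filM.
Qed.

Lemma bounded_idealW d e x :
  (d <= e)%N -> bounded_ideal F S d x -> bounded_ideal F S e x.
Proof.
move=> de; elim=> [|f g z Sf Fg _ IHz]; constructor => //.
exact: filW Fg.
Qed.

Lemma bounded_ideal_fil d e x :
  (forall y, S y -> F e y) -> bounded_ideal F S d x -> F (e + d)%N x.
Proof.
move=> FS; elim=> [|f g z Sf Fg _ IHz]; first exact: fil0.
by apply: filD => //; apply: filM => //; apply: FS.
Qed.

Lemma bounded_ideal_family (I : finType) (f : I -> A) d x :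
    (forall y, S y -> exists i, y = f i) -> bounded_ideal F S d x ->
  exists2 g : I -> A, forall i, F d (g i) & x = \sum_i f i * g i.
Proof.
move=> Sf; elim=> [|y g z /Sf[i ->] Fg _ [h Fh ->]].
  exists (fun=> 0) => [i|]; first exact: fil0.
  by rewrite big1 // => i _; rewrite mulr0.
exists (fun j => (if j == i then g else 0) + h j) => [j|].
  by apply: filD => //; case: eqP => // _; apply: fil0.
under [RHS]eq_bigr do rewrite mulrDr.
rewrite big_split; congr (_ + _) => /=.
by rewrite (bigD1 i) //= eqxx big1 ?addr0 // => j /negPf->; rewrite mulr0.
Qed.

End BoundedIdeal.

Lemma bounded_ideal_map (A B : comNzRingType) (F : filtration A)
    (G : filtration B) (phi : {rmorphism A -> B}) (S : A -> Prop)
    (T : B -> Prop) (w b c : nat) x :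
    (forall d y, F d y -> G (w * d)%N (phi y)) ->
    (forall f, S f -> bounded_ideal G T b (phi f)) ->
    bounded_ideal F S c x -> bounded_ideal G T (w * c + b) (phi x).
Proof.
move=> phiF phiS; elim=> [|f g y Sf Fg _ IHy].
  by rewrite rmorph0; constructor.
rewrite rmorphD rmorphM mulrC; apply: bounded_idealD => //.
by apply: bounded_idealMl; [apply: phiF | apply: phiS].
Qed.

(** * Elimination of one variable *)

(* The library's [map_resultant] only covers morphisms [{poly A} -> B]. *)
Lemma rmorph_resultant (A B : nzRingType) (phi : {rmorphism A -> B})
    (p q : {poly A}) :
    phi (lead_coef p) != 0 -> phi (lead_coef q) != 0 ->
  phi (resultant p q) = resultant (map_poly phi p) (map_poly phi q).
Proof.
move=> lead_p lead_q; rewrite /resultant -det_map_mx.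
have : map_mx phi (Sylvester_mx p q) =
    col_mx (lin1_mx (poly_rV \o map_poly phi p \o* rVpoly))
           (lin1_mx (poly_rV \o map_poly phi q \o* rVpoly)).
  apply/matrixP => i j; rewrite mxE Sylvester_mxE mxE.
  by case: splitP => k _; rewrite mxE /= rVpoly_delta mxE coefXnM coef_map;
    case: ltnP; rewrite ?rmorph0.
by move->; rewrite /Sylvester_mx !size_map_poly_id0.
Qed.

Lemma rVpoly_mul_Sylvester (A : comNzRingType) (p q : {poly A})
    (u : 'rV_(size q).-1) (v : 'rV_(size p).-1) :
  rVpoly (row_mx u v *m Sylvester_mx p q) = rVpoly u * p + rVpoly v * q.
Proof.
have size_mul d (w : 'rV[A]_d) (r : {poly A}) :
    (size (rVpoly w * r)%R <= d + (size r).-1)%N.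
  have [->|r_nz] := eqVneq r 0; first by rewrite mulr0 size_poly0.
  apply: leq_trans (size_polyMleq _ _) _.
  have : (size (rVpoly w) <= d)%N by apply: size_poly.
  by move: r_nz; rewrite -size_poly_gt0; lia.
rewrite mul_row_col raddfD /= !mul_rV_lin1 /= !poly_rV_K //.
by rewrite addnC.
Qed.

Section Elimination.
Variables (A : comNzRingType) (F : filtration A).
Implicit Types p q : {poly A}.

Lemma poly_fil_rVpoly d N (u : 'rV[A]_N) :
  (N <= d.+1)%N -> (forall i, F d (u 0 i)) -> poly_fil F d (rVpoly u).
Proof.
move=> Nd Fu; split=> [|i]; first exact: leq_trans (size_poly _ _) Nd.
by rewrite coef_rVpoly; case: insubP => [j _ _|_]; [apply: Fu | apply: fil0].
Qed.

Lemma fil_Sylvester e p q i j :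
  poly_fil F e p -> poly_fil F e q -> F e (Sylvester_mx p q i j).
Proof.
move=> [_ Fp] [_ Fq]; rewrite Sylvester_mxE.
case: splitP => k _; case: leqP; rewrite ?mulr1n ?mulr0n // => _;
  exact: fil0.
Qed.

(* The multipliers are read off the first row of the adjugate of the Sylvester
   matrix, so their coefficients are cofactors of that matrix. *)
Lemma fil_resultant_Bezout e p q :
    (1 < size p)%N -> (1 < size q)%N -> poly_fil F e p -> poly_fil F e q ->
  F (2 * e * e)%N (resultant p q) /\ exists u v,
    [/\ poly_fil F (2 * e * e) u, poly_fil F (2 * e * e) v &
        (resultant p q)%:P = u * p + v * q].
Proof.
move=> p_nc q_nc Fp Fq; pose S := Sylvester_mx p q.
pose N := ((size q).-1 + (size p).-1)%N.
have [sp _] := Fp; have [sq _] := Fq.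
have N_le : (N * e <= 2 * e * e)%N by apply: leq_mul => //; rewrite /N; lia.
have e_le : (e <= 2 * e * e)%N by case: (e) => // k; apply: leq_pmull.
have [q_le p_le] : ((size q).-1 <= 2 * e * e /\ (size p).-1 <= 2 * e * e)%N.
  by split; apply: leq_trans e_le; rewrite -ltnS prednK // ltnW.
have FS i j : F e (S i j) by apply: fil_Sylvester.
split; first exact: filW N_le (fil_det FS).
have N_gt0 : (0 < N)%N by rewrite /N; lia.
pose w := row (Ordinal N_gt0) (\adj S).
have Fw i : F (2 * e * e)%N (w 0 i).
  by rewrite !mxE; apply: filW N_le _; apply: fil_cofactor.
exists (rVpoly (lsubmx w)), (rVpoly (rsubmx w)); split.
- by apply: poly_fil_rVpoly => [|i]; [apply: leqW | rewrite mxE].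
- by apply: poly_fil_rVpoly => [|i]; [apply: leqW | rewrite mxE].
rewrite -rVpoly_mul_Sylvester hsubmxK -row_mul mul_adj_mx -scalemx1 linearZ /=.
by rewrite row1 linearZ /= rVpoly_delta expr0 alg_polyC.
Qed.

Definition elimination_degree (e : nat) : nat := (8 * e.+1 ^ 2)%N.

(* [q] is first replaced by [q + X^(e+1) p], which has the same leading
   coefficient as [p], so that [ev] commutes with the resultant. *)
Lemma elimination (L : closedFieldType) (ev : {rmorphism A -> L}) e p q :
    poly_fil F e p -> poly_fil F e q -> (1 < size p)%N ->
    ev (lead_coef p) != 0 ->
    (forall t, root (map_poly ev p) t -> ~~ root (map_poly ev q) t) ->
  exists r u v, [/\ F (elimination_degree e) r, ev r != 0,
    poly_fil F (elimination_degree e) u, poly_fil F (elimination_degree e) v &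
    r%:P = u * p + v * q].
Proof.
move=> Fp Fq p_nc ev_p no_root; pose q' := q + 'X^(e.+1) * p.
have p_nz : p != 0 by rewrite -size_poly_gt0 ltnW.
have size_Xp : size ('X^(e.+1) * p) = (e.+1 + size p)%N.
  by rewrite mulrC size_mulXn.
have q_small : (size q < size ('X^(e.+1) * p)%R)%N.
  by rewrite size_Xp; case: Fq => sq _; lia.
have q'_nc : (1 < size q')%N by rewrite /q' addrC size_polyDl // size_Xp; lia.
have lead_q' : lead_coef q' = lead_coef p.
  by rewrite lead_coefDr // lead_coef_monicM ?monicXn.
have b_le : (2 * (2 * e + 1) * (2 * e + 1) + e.+1 <= elimination_degree e)%N.
  by rewrite /elimination_degree; nia.
have Fq' : poly_fil F (2 * e + 1) q'.
  apply: filD; first by apply: filW Fq; lia.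
  apply: (@filW _ _ (e.+1 + e)); first by lia.
  by apply: filM => //; apply: poly_filXn.
have Fp' : poly_fil F (2 * e + 1) p by apply: filW Fp; lia.
have [Fr [u [v [Fu Fv rE]]]] := fil_resultant_Bezout p_nc q'_nc Fp' Fq'.
exists (resultant p q'), (u + v * 'X^(e.+1)), v; split.
- by apply: filW Fr; apply: leq_trans b_le; apply: leq_addr.
- rewrite rmorph_resultant ?lead_q' // resultant_eq0 -leqNgt leqNgt.
  apply/negP => gcd_nc.
  have /closed_rootP[t] : size (gcdp (map_poly ev p) (map_poly ev q')) != 1.
    by rewrite gtn_eqF.
  rewrite root_gcd => /andP[p_t]; have := no_root t p_t.
  by rewrite rmorphD rmorphM /root !hornerE (rootP p_t) mulr0 addr0 => /negPf->.
- apply: filW b_le _; apply: filD; first by apply: filW Fu; lia.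
  by apply: filM => //; apply: poly_filXn.
- by apply: filW Fv; apply: leq_trans b_le; apply: leq_addr.
by rewrite rE /q'; ring.
Qed.

End Elimination.

(** * Nagata change of variables *)

Lemma base_expansion_inj n B (a b : 'I_n -> nat) :
    (forall i, (a i < B)%N) -> (forall i, (b i < B)%N) ->
    (\sum_(i < n) a i * B ^ i = \sum_(i < n) b i * B ^ i)%N ->
  a =1 b.
Proof.
elim: n a b => [|n IHn] a b aB bB; first by move=> _ [].
rewrite !big_ord_recl /= !expn0 !muln1.
have shift (c : 'I_n.+1 -> nat) :
    (\sum_(i < n) c (lift ord0 i) * B ^ (bump 0 i) =
     (\sum_(i < n) c (lift ord0 i) * B ^ i) * B)%N.
  by rewrite big_distrl /=; apply: eq_bigr => i _; rewrite expnSr mulnA.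
rewrite !shift => eq_ab.
have B_gt0 : (0 < B)%N by apply: leq_ltn_trans (aB ord0).
have ab0 : a ord0 = b ord0.
  have := congr1 (modn^~ B) eq_ab.
  by rewrite ![(_ + _ * B)%N]addnC !modnMDl !modn_small.
move: eq_ab; rewrite ab0 => /addnI/eqP; rewrite eqn_pmul2r // => /eqP eq_ab i.
case: (unliftP ord0 i) => [j ->|->] //.
by apply: (IHn (a \o lift ord0) (b \o lift ord0)) => //= k.
Qed.

Lemma size_prod_monic (R : nzRingType) (I : Type) (r : seq I)
    (E : I -> {poly R}) : (forall i, E i \is monic) ->
  (size (\prod_(i <- r) E i)%R).-1 = (\sum_(i <- r) (size (E i)).-1)%N.
Proof.
move=> monE; elim: r => [|i r IHr]; first by rewrite !big_nil size_poly1.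
have mon_prod : \prod_(j <- r) E j \is monic by apply: monic_prod.
rewrite !big_cons -IHr size_monicM ?monic_neq0 //.
have := monic_neq0 (monE i); have := monic_neq0 mon_prod.
by rewrite -!size_poly_gt0; lia.
Qed.

Lemma lead_coef_sum_monic (R : nzRingType) (I : eqType) (r : seq I)
    (c : I -> R) (P : I -> {poly R}) :
    r != [::] -> uniq r -> {in r, forall i, c i != 0} ->
    (forall i, P i \is monic) -> {in r &, injective (fun i => size (P i))} ->
  exists2 i, i \in r & lead_coef (\sum_(i <- r) c i *: P i) = c i.
Proof.
move=> r_nz uniq_r c_nz monP injP.
have size_cP i : i \in r -> size (c i *: P i) = size (P i).
  move=> /c_nz ci; rewrite -mul_polyC size_Mmonic ?polyC_eq0 //.
  by rewrite size_polyC ci.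
have lead_cP i : lead_coef (c i *: P i) = c i.
  by rewrite -mul_polyC lead_coef_Mmonic // lead_coefC.
suff [i ir [_ ->]] : exists2 i, i \in r &
    size (\sum_(i <- r) c i *: P i) = size (P i) /\
    lead_coef (\sum_(i <- r) c i *: P i) = c i by exists i.
elim: r r_nz uniq_r {c_nz} injP size_cP => // i r IHr _ /=.
move=> /andP[i_r uniq_r] injP size_cP.
rewrite !big_cons; have [r_nil|r_nz] := eqVneq r [::].
  by exists i; rewrite ?mem_head // r_nil big_nil addr0 size_cP ?mem_head.
have sub_r j : j \in r -> j \in i :: r by rewrite inE => ->; rewrite orbT.
have [||j jr [size_sum lead_sum]] := IHr r_nz uniq_r.
- by move=> j k /sub_r jr /sub_r kr; apply: injP.
- by move=> j /sub_r; apply: size_cP.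
have size_i : size (c i *: P i) = size (P i) by rewrite size_cP ?mem_head.
have [lt_ij|lt_ji|eq_ij] := ltngtP (size (P i)) (size (P j)).
- exists j; first exact: sub_r.
  by rewrite addrC size_polyDl ?lead_coefDl ?size_i ?size_sum.
- exists i; first exact: mem_head.
  by rewrite size_polyDl ?lead_coefDl ?size_i ?size_sum.
by case/negP: i_r; rewrite (injP i j) ?mem_head ?sub_r.
Qed.

Lemma rmorph_mmap n (R : nzRingType) (A B : comNzRingType)
    (phi : {rmorphism A -> B}) (c : R -> A) (g : 'I_n -> A) (p : {mpoly R[n]}) :
  phi (mmap c g p) = mmap (phi \o c) (phi \o g) p.
Proof.
rewrite /mmap rmorph_sum; apply: eq_bigr => m _.
rewrite rmorphM rmorph_prod; congr (_ * _); apply: eq_bigr => i _.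
by rewrite rmorphXn.
Qed.

Lemma eq_mmap n (R A : nzRingType) (c c' : R -> A) (g g' : 'I_n -> A)
    (p : {mpoly R[n]}) :
  c =1 c' -> g =1 g' -> mmap c g p = mmap c' g' p.
Proof.
move=> cc' gg'; apply: eq_bigr => m _; rewrite cc'; congr (_ * _).
exact: mmap1_eq.
Qed.

Section Nagata.
Variables (R : idomainType) (n B : nat).

(* [X_0] is sent to [T^(B^0) = T], and [X_(i+1)] to [X_i + T^(B^(i+1))]. *)
Definition nagata_var (k : 'I_n.+1) : {poly {mpoly R[n]}} :=
  (if unlift ord0 k is Some i then 'X_i else 0)%:P + 'X^(B ^ k).

Definition nagata (p : {mpoly R[n.+1]}) : {poly {mpoly R[n]}} :=
  mmap (polyC \o @mpolyC n R) nagata_var p.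

HB.instance Definition _ := GRing.RMorphism.copy nagata
  (mmap (polyC \o @mpolyC n R) nagata_var).

Definition nagata_inv_coef (p : {mpoly R[n]}) : {mpoly R[n.+1]} :=
  mmap (@mpolyC n.+1 R)
    (fun i => 'X_(lift ord0 i) - 'X_ord0 ^+ (B ^ i.+1)) p.

HB.instance Definition _ := GRing.RMorphism.copy nagata_inv_coef
  (mmap (@mpolyC n.+1 R)
    (fun i => 'X_(lift ord0 i) - 'X_ord0 ^+ (B ^ i.+1))).

Definition nagata_inv (P : {poly {mpoly R[n]}}) : {mpoly R[n.+1]} :=
  horner_eval 'X_ord0 (map_poly nagata_inv_coef P).

HB.instance Definition _ := GRing.RMorphism.copy nagata_inv
  (horner_eval ('X_ord0 : {mpoly R[n.+1]}) \o map_poly nagata_inv_coef).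

Lemma nagata_invC p : nagata_inv p%:P = nagata_inv_coef p.
Proof. by rewrite /nagata_inv map_polyC /horner_eval hornerC. Qed.

Lemma nagata_invX : nagata_inv 'X = 'X_ord0.
Proof. by rewrite /nagata_inv map_polyX /horner_eval hornerX. Qed.

Lemma nagataK : cancel nagata nagata_inv.
Proof.
move=> p; rewrite /nagata rmorph_mmap -[RHS]comp_mpoly_id.
apply: eq_mmap => [c|k] /=; first by rewrite nagata_invC /nagata_inv_coef mmapC.
rewrite tnth_mktuple /nagata_var rmorphD rmorphXn /= nagata_invX nagata_invC.
case: unliftP => [i ->|->]; last by rewrite rmorph0 add0r expn0 expr1.
by rewrite /nagata_inv_coef mmapX mmap1U subrK.
Qed.

Definition nagata_point (x : 'I_n -> R) (t : R) (k : 'I_n.+1) : R :=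
  (if unlift ord0 k is Some i then x i else 0) + t ^+ (B ^ k).

Lemma horner_nagata (x : 'I_n -> R) t (p : {mpoly R[n.+1]}) :
  (map_poly (meval x) (nagata p)).[t] = p.@[nagata_point x t].
Proof.
rewrite -/(horner_eval t _) -/((horner_eval t \o map_poly (meval x)) _).
rewrite rmorph_mmap; apply: eq_mmap => [c|k] /=.
  by rewrite map_polyC /= mevalC /horner_eval hornerC.
rewrite /nagata_var /nagata_point rmorphD rmorphXn /= map_polyX map_polyC.
rewrite /horner_eval !hornerE /=.
by case: unlift => [i|]; rewrite ?mevalXU ?meval0.
Qed.

Hypothesis B_gt0 : (0 < B)%N.

Lemma poly_fil_nagata d p :
  degree_le d p -> poly_fil (@degree_le R n) (B ^ n * d) (nagata p).
Proof.
rewrite degree_leE => pd; apply: fil_mmap pd => [c|k] /=.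
  exact/poly_filC/degree_leC.
apply: filD.
  apply: poly_filC; case: unlift => [i|] /=; last exact: fil0.
  by apply: filW (degree_leXU _ _); rewrite expn_gt0 B_gt0.
apply: filW (poly_filXn _ _).
by rewrite leq_pexp2l // -ltnS.
Qed.

Lemma degree_le_nagata_inv_coef d p :
  degree_le d p -> degree_le (B ^ n * d) (nagata_inv_coef p).
Proof.
rewrite degree_leE => pd; apply: fil_mmap pd => [c|i] /=.
  exact: degree_leC.
apply: filD; first by apply: filW (degree_leXU _ _); rewrite expn_gt0 B_gt0.
by apply: filN; apply: filW (degree_leXn _ _ _); rewrite leq_pexp2l.
Qed.

Lemma degree_le_nagata_inv d P :
  poly_fil (@degree_le R n) d P -> degree_le (B ^ n * d + d) (nagata_inv P).
Proof.
move=> [sP FP]; rewrite /nagata_inv /horner_eval horner_coef.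
apply: fil_sum => i _; rewrite coef_map; apply: filM.
  exact: degree_le_nagata_inv_coef.
apply: filW (degree_leXn _ _ _); rewrite -ltnS.
by apply: leq_trans sP; apply: leq_trans (ltn_ord i) (size_poly _ _).
Qed.

Lemma monic_nagata_var k : nagata_var k \is monic.
Proof.
rewrite monicE /nagata_var lead_coefDr ?lead_coefXn // size_polyXn.
by rewrite (leq_ltn_trans (size_polyC_leq1 _)) // ltnS expn_gt0 B_gt0.
Qed.

Lemma size_nagata_var k : size (nagata_var k) = (B ^ k).+1.
Proof.
rewrite /nagata_var addrC size_polyDl size_polyXn //.
by rewrite (leq_ltn_trans (size_polyC_leq1 _)) // ltnS expn_gt0 B_gt0.
Qed.

Lemma monic_nagata_mmap1 m : mmap1 nagata_var m \is monic.
Proof. by apply: monic_prod => k _; rewrite monic_exp ?monic_nagata_var. Qed.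

Lemma size_nagata_mmap1 (m : 'X_{1..n.+1}) :
  size (mmap1 nagata_var m) = (\sum_(i < n.+1) m i * B ^ i).+1.
Proof.
rewrite -[LHS]prednK ?size_poly_gt0 ?monic_neq0 ?monic_nagata_mmap1 //.
rewrite size_prod_monic => [|k]; last by rewrite monic_exp ?monic_nagata_var.
by congr _.+1; apply: eq_bigr => k _; rewrite size_exp size_nagata_var mulnC.
Qed.

(* Base-[B] expansions are unique, so the images of the monomials of [p] have
   pairwise distinct degrees in [T]. *)
Lemma lead_coef_nagata p : (msize p <= B)%N -> p != 0 ->
  exists2 c : R, c != 0 & lead_coef (nagata p) = c%:MP.
Proof.
move=> pB p_nz.
have exponent_ltB m i : m \in msupp p -> (m i < B)%N.
  move=> /msize_mdeg_lt mp; apply: leq_trans pB; apply: leq_ltn_trans mp.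
  by rewrite mdegE (bigD1 i) //= leq_addr.
have [|||||m mp lead_p] := @lead_coef_sum_monic _ _ (msupp p)
    (fun m => (p@_m)%:MP_[n]) (mmap1 nagata_var).
- by rewrite msupp_eq0.
- exact: msupp_uniq.
- by move=> m mp; rewrite mpolyC_eq0 -mcoeff_msupp.
- exact: monic_nagata_mmap1.
- move=> m m' mp m'p.
  rewrite !size_nagata_mmap1 => -[/base_expansion_inj eq_mm'].
  by apply/mnmP => i; apply: eq_mm' => j; apply: exponent_ltB.
exists p@_m; first by rewrite -mcoeff_msupp.
rewrite -lead_p /nagata /mmap; congr lead_coef.
by apply: eq_bigr => m' _; rewrite mul_polyC.
Qed.

End Nagata.

(** * Nullstellensatz with a degree bound *)

Lemma bounded_ideal_avoid_zeros (L : closedFieldType) n (T : eqType)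
    (S : {mpoly L[n]} -> Prop) (z : T -> 'I_n -> L) (r : seq T) :
    (forall x, exists2 f, S f & f.@[x] != 0) ->
  exists2 f, bounded_ideal (@degree_le L n) S 0 f &
    forall t, t \in r -> f.@[z t] != 0.
Proof.
move=> S_nz; elim: r => [|t r [f Sf f_nz]].
  by exists 0 => //; constructor.
have [g Sg g_nz] := S_nz (z t).
pose P u : {poly L} := (g.@[z u])%:P * 'X + (f.@[z u])%:P.
have P_nz : \prod_(u <- t :: r) P u != 0.
  rewrite prodf_seq_neq0; apply/allP => u ur /=.
  rewrite -size_poly_gt0 size_MXaddC polyC_eq0.
  move: ur; rewrite inE => /predU1P[->|/f_nz]; first by rewrite (negPf g_nz).
  by case: ifP => // /andP[_ /eqP->]; rewrite eqxx.
have [c] := closed_nonrootP _ P_nz.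
rewrite /root horner_prod prodf_seq_neq0 => /allP c_nz.
exists (g * c%:MP + f) => [|u ur].
  apply: bounded_idealD => //.
  by apply: bounded_ideal_mem => //; apply: degree_leC.
by have /= := c_nz u ur; rewrite /P !hornerE mevalD mevalM mevalC.
Qed.

(* The degree in [T] and in the remaining variables becomes at most
   [(d + 1)^n * d] under the change of variables; the extra [1] accounts for
   the factor [T] that makes the eliminated polynomial nonconstant. *)
Definition eliminant_degree (n d : nat) : nat :=
  elimination_degree (d.+1 ^ n * d).+1.

Fixpoint nullstellensatz_degree (n d : nat) : nat :=
  if n is n'.+1 then
    let b := eliminant_degree n' d in
    (d.+1 ^ n' * nullstellensatz_degree n' b + (d.+1 ^ n' * b + b.+1))%N
  else 0.

Section NullstellensatzStep.
Variables (L : closedFieldType) (n d : nat) (S : {mpoly L[n.+1]} -> Prop).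
Hypothesis S_deg : forall f, S f -> degree_le d f.
Hypothesis S_nz : forall x, exists2 f, S f & f.@[x] != 0.

Local Notation B := d.+1.
Local Notation b := (eliminant_degree n d).

Definition eliminant (p : {mpoly L[n]}) : Prop :=
  degree_le b p /\
  bounded_ideal (@degree_le L n.+1) S (B ^ n * b + b.+1) (nagata_inv B p%:P).

Lemma exists_eliminant_neq0 (x : 'I_n -> L) :
  exists2 p, eliminant p & p.@[x] != 0.
Proof.
have [f Sf f0] := S_nz (fun=> 0).
have f_nz : f != 0 by apply: contraNneq f0 => ->; rewrite meval0.
have f_deg : (msize f <= B)%N by rewrite -degree_leE; apply: S_deg.
have [c c_nz lead_f] := lead_coef_nagata (ltn0Sn d) f_deg f_nz.
have nagata_f_nz : nagata B f != 0 by rewrite -lead_coef_eq0 lead_f mpolyC_eq0.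
pose P := nagata B f * 'X.
have lead_P : (lead_coef P).@[x] != 0 by rewrite lead_coefMX lead_f mevalC.
have [r rP] : exists r : seq L,
    forall t, root (map_poly (meval x) P) t -> t \in r.
  have [r PE] := closed_field_poly_normal (map_poly (meval x) P); exists r => t.
  by rewrite PE rootZ ?root_prod_XsubC // lead_coef_map_eq.
have [g Sg g_nz] := bounded_ideal_avoid_zeros (nagata_point B x) r S_nz.
have g_deg : degree_le d g by rewrite -[d]addn0; apply: bounded_ideal_fil Sg.
have [||||t Pt|q [u [v [q_deg qx u_deg v_deg qE]]]] :=
  @elimination _ (@degree_le L n) _ (meval x) (B ^ n * d).+1 P (nagata B g).
- rewrite -addn1; apply: filM; last exact: poly_filX.
  by apply: poly_fil_nagata => //; apply: S_deg.
- by apply: filW (leqnSn _) _; apply: poly_fil_nagata.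
- by rewrite size_mulX ?ltnS ?size_poly_gt0.
- exact: lead_P.
- by rewrite /root horner_nagata; apply/g_nz/rP.
exists q => //; split=> //.
rewrite qE !(rmorphD, rmorphM) /= nagata_invX !nagataK.
apply: bounded_idealD.
  rewrite mulrCA; apply: bounded_ideal_mem => //; rewrite -[b.+1]addn1 addnA.
  by apply: filM; [apply: degree_le_nagata_inv | apply: degree_leXU].
apply: (@bounded_idealW _ _ _ (B ^ n * b + b + 0)); first by lia.
by apply: bounded_idealMl => //; apply: degree_le_nagata_inv.
Qed.

Lemma nullstellensatz_step c :
    bounded_ideal (@degree_le L n) eliminant c 1 ->
  bounded_ideal (@degree_le L n.+1) S (B ^ n * c + (B ^ n * b + b.+1)) 1.
Proof.
move=> I1.
rewrite -[X in bounded_ideal _ _ _ X](rmorph1 (@nagata_inv L n B \o polyC)).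
apply: bounded_ideal_map I1 => [k p p_deg|p [] //].
by rewrite /= nagata_invC; apply: degree_le_nagata_inv_coef.
Qed.

End NullstellensatzStep.

Theorem effective_nullstellensatz (L : closedFieldType) n d
    (S : {mpoly L[n]} -> Prop) :
    (forall f, S f -> degree_le d f) ->
    (forall x, exists2 f, S f & f.@[x] != 0) ->
  bounded_ideal (@degree_le L n) S (nullstellensatz_degree n d) 1.
Proof.
elim: n d S => [|n IHn] d S S_deg S_nz.
  have [f Sf] := S_nz (fun=> 0); rewrite -[f]mpolyKC mevalC => f_nz.
  have <- : f * ((f@_0)^-1)%:MP = 1 by rewrite -{1}[f]mpolyKC -mpolyCM divff.
  by apply: bounded_ideal_mem => //; apply: degree_leC.
apply: nullstellensatz_step; apply: IHn => [p []//|x].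
exact: exists_eliminant_neq0.
Qed.

(** * Linear systems and Cramer's rule *)

Lemma inj_map_mx (aT rT : Type) (f : aT -> rT) m n :
  injective f -> injective (@map_mx aT rT f m n).
Proof.
move=> f_inj A B /matrixP eq_fAB; apply/matrixP => i j.
by apply: f_inj; have := eq_fAB i j; rewrite !mxE.
Qed.

Lemma sum_enum_val (V : nmodType) (I : finType) (E : I -> V) :
  \sum_i E i = \sum_(i < #|I|) E (enum_val i).
Proof. by rewrite -(big_enum_val (A := I)). Qed.

Lemma cramer_minor (R : idomainType) (L : fieldType) (phi : {rmorphism R -> L})
    m k (A : 'M[R]_(m, k)) (u : 'rV[R]_k) :
    injective phi -> (map_mx phi u <= map_mx phi A)%MS ->
  exists r (f : 'I_r -> 'I_m) (g : 'I_r -> 'I_k), [/\ (r <= k)%N,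
    \det (mxsub f g A) != 0 &
    colsub g u *m \adj (mxsub f g A) *m rowsub f A = \det (mxsub f g A) *: u].
Proof.
move=> phi_inj uA; pose AL := map_mx phi A; pose f := maxrankfun AL.
have fullT : row_full (rowsub f AL)^T.
  by rewrite /row_full mxrank_tr; apply: maxrowsub_free.
pose g := fullrankfun fullT.
exists (\rank AL), f, g.
have BL : map_mx phi (mxsub f g A) = (rowsub g (rowsub f AL)^T)^T.
  by apply/matrixP => i j; rewrite !mxE.
have detB : phi (\det (mxsub f g A)) != 0.
  by rewrite -det_map_mx BL det_tr -unitfE -unitmxE fullrowsub_unit.
split; first exact: rank_leq_col.
  by apply: contraNneq detB => ->; rewrite rmorph0.
have [w uw] : exists w, map_mx phi u = w *m rowsub f AL.
  by apply/submxP; rewrite eq_maxrowsub.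
apply: (inj_map_mx phi_inj); rewrite !map_mxM map_mxZ uw map_mx_adj.
have -> : map_mx phi (colsub g u) = w *m map_mx phi (mxsub f g A).
  rewrite map_mxsub uw -mulmx_colsub; congr (_ *m _).
  by apply/matrixP => i j; rewrite !mxE.
rewrite -[w *m _ *m _]mulmxA mul_mx_adj mul_mx_scalar det_map_mx -scalemxAl.
by rewrite map_mxsub.
Qed.

Lemma mcoeff_sum_bmnm (R : comNzRingType) n k (v : 'X_{1..n < k} -> R)
    (m : 'X_{1..n < k}) : (\sum_m v m *: 'X_[m])@_m = v m.
Proof.
rewrite raddf_sum (bigD1 m) //= mcoeffZ mcoeffX eqxx mulr1 big1 ?addr0 // => m'.
by rewrite mcoeffZ mcoeffX -val_eqE => /negPf->; rewrite mulr0.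
Qed.

Lemma mpolywP (R : comNzRingType) n k (p q : {mpoly R[n]}) :
    (msize p <= k)%N -> (msize q <= k)%N ->
    (forall m : 'X_{1..n < k}, p@_m = q@_m) ->
  p = q.
Proof.
move=> pk qk eq_pq; rewrite (mpolywE pk) (mpolywE qk).
by apply: eq_bigr => m _; rewrite eq_pq.
Qed.

Lemma mcoeff_sum_mulw (R : comNzRingType) n k (I : finType)
    (f g : I -> {mpoly R[n]}) m : (forall i, msize (g i) <= k)%N ->
  (\sum_i f i * g i)@_m =
    \sum_(x : I * 'X_{1..n < k}) (g x.1)@_x.2 * (f x.1 * 'X_[x.2])@_m.
Proof.
move=> gk; rewrite -(pair_bigA _ (fun i (m' : 'X_{1..n < k}) =>
  (g i)@_m' * (f i * 'X_[m'])@_m)) /= raddf_sum; apply: eq_bigr => i _.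
rewrite [g i in LHS](mpolywE (gk i)) mulr_sumr raddf_sum.
by apply: eq_bigr => m' _; rewrite /= -scalerAr mcoeffZ.
Qed.

(** * Solutions of bounded height *)

Lemma le_poly_height (RR : realType) (R : idomainType) (h : R -> RR) n
    (p : {mpoly R[n]}) m : m \in msupp p -> h p@_m <= poly_height h p.
Proof. by move=> mp; rewrite /poly_height; apply: le_bigmax_seq. Qed.

Lemma poly_height_le (RR : realType) (R : idomainType) (h : R -> RR) n
    (p : {mpoly R[n]}) (C : RR) : 0 <= C ->
  (forall m, m \in msupp p -> h p@_m <= C) -> poly_height h p <= C.
Proof.
move=> C_ge0 hC; rewrite /poly_height big_seq_cond.
by apply: bigmax_le => // m /andP[/hC].
Qed.

Definition is_solution (RR : realType) (R : idomainType) (h : R -> RR) n s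
    (f : 'I_s -> {mpoly R[n]}) (c : nat) (C : RR) (a : R)
    (g : 'I_s -> {mpoly R[n]}) : Prop :=
  [/\ a != 0, a%:MP = \sum_i f i * g i, forall i, degree_le c (g i), h a <= C &
      forall i, poly_height h (g i) <= C].

Lemma is_solutionW (RR : realType) (R : idomainType) (h : R -> RR) n s
    (f g : 'I_s -> {mpoly R[n]}) c c' C C' a : (c <= c')%N -> C <= C' ->
  is_solution h f c C a g -> is_solution h f c' C' a g.
Proof.
move=> cc' CC' [a_nz agE g_deg a_C g_C]; split=> // [i||i].
- exact: filW (g_deg i).
- exact: le_trans CC'.
- exact: le_trans CC'.
Qed.

Fixpoint height_bound (theta : nat -> nat) (b k : nat) : nat :=
  if k is k'.+1 then
    maxn (height_bound theta b k') (theta (height_bound theta b k'))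
  else b.

Lemma leq_height_bound theta b : {homo height_bound theta b : j k / (j <= k)%N}.
Proof.
by apply: homo_leq => [//|j k l|k] /=; [apply: leq_trans | apply: leq_maxl].
Qed.

Definition cramer_level (k N : nat) : nat := (k + 3 * N + 4 + N`!)%N.

Definition macaulay_level (n d : nat) : nat :=
  cramer_level 2 #|{: 'X_{1..n < (d + nullstellensatz_degree n d).+1}}|.

Section HeightLevels.
Variables (RR : realType) (R : idomainType) (theta : nat -> nat) (h : R -> RR).
Hypothesis h_type : height_of_type theta h.
Variable b : nat.
Hypothesis hN1 : h (-1) <= b%:R.

Definition height_level (k : nat) (x : R) : Prop :=
  h x <= (height_bound theta b k)%:R.

Lemma height_levelW j k x : (j <= k)%N -> height_level j x -> height_level k x.
Proof.
by move=> jk /le_trans; apply; rewrite ler_nat leq_height_bound.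
Qed.

Lemma height_levelD k x y :
  height_level k x -> height_level k y -> height_level k.+1 (x + y).
Proof.
move=> hx hy; have [+ _] := h_type.2 _ _ _ hx hy.
by move/le_trans; apply; rewrite ler_nat leq_maxr.
Qed.

Lemma height_levelM k x y :
  height_level k x -> height_level k y -> height_level k.+1 (x * y).
Proof.
move=> hx hy; have [_ +] := h_type.2 _ _ _ hx hy.
by move/le_trans; apply; rewrite ler_nat leq_maxr.
Qed.

Lemma height_level1 k : (0 < k)%N -> height_level k 1.
Proof.
move=> k_gt0; apply: height_levelW k_gt0 _.
by rewrite -[1]mul1r -mulrNN; apply: height_levelM.
Qed.

Lemma height_level0 k : (1 < k)%N -> height_level k 0.
Proof.
move=> k_gt1; apply: height_levelW k_gt1 _; rewrite -(subrr 1).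
by apply: height_levelD; [apply: height_level1 | apply: (@height_levelW 0)].
Qed.

Lemma height_level_natb k (c : bool) : (1 < k)%N -> height_level k c%:R.
Proof.
move=> k_gt1; case: c; last exact: height_level0.
exact/height_level1/ltnW.
Qed.

Lemma height_level_sign k j : (0 < k)%N -> height_level k ((-1) ^+ j).
Proof.
move=> k_gt0; rewrite -signr_odd; case: odd; last exact: height_level1.
exact: (@height_levelW 0).
Qed.

Lemma height_level_big (op : R -> R -> R) x0 (I : finType) (E : I -> R) k :
    (forall j x y, height_level j x -> height_level j y ->
      height_level j.+1 (op x y)) ->
    height_level k x0 -> (forall i, height_level k (E i)) ->
  height_level (k + #|I|) (\big[op/x0]_i E i).
Proof.
move=> h_op h_x0 hE; have -> : #|I| = size (index_enum I).
  by rewrite cardT enumT [index_enum I]unlock.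
elim: (index_enum I) => [|i r IHr]; first by rewrite big_nil addn0.
rewrite big_cons addnS; apply: h_op => //.
by apply: height_levelW (hE i); apply: leq_addr.
Qed.

Lemma height_level_sum (I : finType) (E : I -> R) k : (1 < k)%N ->
  (forall i, height_level k (E i)) -> height_level (k + #|I|) (\sum_i E i).
Proof.
move=> k_gt1; apply: height_level_big; first exact: height_levelD.
exact: height_level0.
Qed.

Lemma height_level_prod (I : finType) (E : I -> R) k : (1 < k)%N ->
  (forall i, height_level k (E i)) -> height_level (k + #|I|) (\prod_i E i).
Proof.
move=> k_gt1; apply: height_level_big; first exact: height_levelM.
exact/height_level1/ltnW.
Qed.

Definition mx_height_level (k m n : nat) (A : 'M[R]_(m, n)) : Prop :=
  forall i j, height_level k (A i j).

Lemma mx_height_level_mul k m r n (A : 'M[R]_(m, r)) (B : 'M[R]_(r, n)) :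
    (1 < k)%N -> mx_height_level k A -> mx_height_level k B ->
  mx_height_level (k.+1 + r) (A *m B).
Proof.
move=> k_gt1 hA hB i j; rewrite mxE -[r in (_ + r)%N]card_ord.
by apply: height_level_sum => [|l]; [apply: ltnW | apply: height_levelM].
Qed.

Lemma height_level_det N (A : 'M[R]_N) k :
  (1 < k)%N -> mx_height_level k A -> height_level ((k + N).+1 + N`!) (\det A).
Proof.
move=> k_gt1 hA; rewrite -card_Sn; apply: height_level_sum => [|s].
  by rewrite ltnS ltn_addr // ltnW.
apply: height_levelM.
  by apply: height_level_sign; rewrite ltn_addr // ltnW.
by rewrite -[N in (_ + N)%N]card_ord; apply: height_level_prod.
Qed.

Lemma mx_height_level_adj N (A : 'M[R]_N) k :
    (1 < k)%N -> mx_height_level k A ->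
  mx_height_level ((k + N).+2 + N`!) (\adj A).
Proof.
move=> k_gt1 hA i j; rewrite mxE addSn; apply: height_levelM.
  exact: height_level_sign.
have hA' : mx_height_level k (row' j (col' i A)) by move=> l l'; rewrite !mxE.
apply: height_levelW (height_level_det k_gt1 hA').
case: (N) => // N'; have : (N'`! <= N'.+1`!)%N by rewrite factS leq_pmull.
by rewrite /=; lia.
Qed.

Section LinearSystem.
Variables (L : fieldType) (phi : {rmorphism R -> L}).
Hypothesis phi_inj : injective phi.

Lemma mx_linear_solution m N (A : 'M[R]_(m, N)) (u : 'rV[R]_N) k :
    (map_mx phi u <= map_mx phi A)%MS -> (1 < k)%N ->
    mx_height_level k A -> mx_height_level k u ->
  exists a (v : 'rV[R]_m), [/\ a != 0, v *m A = a *: u,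
    height_level (cramer_level k N) a &
    mx_height_level (cramer_level k N) v].
Proof.
move=> /(cramer_minor phi_inj)[r [f [g [r_le det_nz cramer]]]] k_gt1 hA hu.
have r_fact : (r`! <= N`!)%N by apply: leq_fact.
have hB : mx_height_level k (mxsub f g A) by move=> i j; rewrite mxE.
exists (\det (mxsub f g A)).
exists (colsub g u *m \adj (mxsub f g A) *m rowsub f 1%:M); split=> //.
- by rewrite -mulmxA -rowsubE.
- apply: height_levelW (height_level_det k_gt1 hB).
  by rewrite /cramer_level; lia.
pose adj_level := ((k + r).+2 + r`!)%N; pose mul_level := (adj_level.+1 + r)%N.
move=> i j; apply: (@height_levelW (mul_level.+1 + r)).
  by rewrite /cramer_level /mul_level /adj_level; lia.
apply: mx_height_level_mul => [|i' j'|i' j'].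
- by rewrite /mul_level /adj_level; lia.
- apply: mx_height_level_mul => [|i0 j0|]; last exact: mx_height_level_adj.
    by rewrite /adj_level; lia.
  by rewrite mxE; apply: height_levelW (hu _ _); rewrite /adj_level; lia.
by rewrite !mxE; apply: height_level_natb; rewrite /mul_level /adj_level; lia.
Qed.

Lemma linear_solution (I J : finType) (A : I -> J -> R) (u : J -> R)
    (w : I -> L) k :
    (forall j, \sum_i w i * phi (A i j) = phi (u j)) -> (1 < k)%N ->
    (forall i j, height_level k (A i j)) -> (forall j, height_level k (u j)) ->
  exists a (v : I -> R), [/\ a != 0, forall j, \sum_i v i * A i j = a * u j,
    height_level (cramer_level k #|J|) a &
    forall i, height_level (cramer_level k #|J|) (v i)].
Proof.
move=> wA k_gt1 hA hu.
pose M := \matrix_(i < #|I|, j < #|J|) A (enum_val i) (enum_val j).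
pose U := \row_(j < #|J|) u (enum_val j).
have [|i j|i j|a [v [a_nz vM ha hv]]] := @mx_linear_solution _ _ M U _ _ k_gt1.
- apply/submxP; exists (\row_i w (enum_val i)); apply/rowP => j.
  by rewrite !mxE -wA sum_enum_val; apply: eq_bigr => i _; rewrite !mxE.
- by rewrite mxE.
- by rewrite mxE.
exists a, (fun i => v 0 (enum_rank i)); split=> // j.
have /rowP/(_ (enum_rank j)) := vM; rewrite !mxE enum_rankK => <-.
rewrite sum_enum_val; apply: eq_bigr => i _.
by rewrite mxE enum_rankK enum_valK.
Qed.

End LinearSystem.

Section BoundedSolution.
Variables (L : closedFieldType) (phi : {rmorphism R -> L}).
Hypothesis phi_inj : injective phi.
Variables (n d s : nat) (f : 'I_s -> {mpoly R[n]}).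
Hypothesis f_deg : forall i, degree_le d (f i).
Hypothesis f_height : forall i, poly_height h (f i) <= b%:R.
Hypothesis f_nz : forall x, exists i, (map_mpoly phi (f i)).@[x] != 0.

Let c := nullstellensatz_degree n d.

Lemma height_level_macaulay i m m' : height_level 2 (f i * 'X_[m])@_m'.
Proof.
have [|/memN_msupp_eq0->] := boolP (m' \in msupp (f i * 'X_[m])); last first.
  exact: height_level0.
rewrite (perm_mem (msuppMX _ _)) => /mapP[m0 m0f ->]; rewrite mcoeffMX.
apply: (@height_levelW 0) => //.
exact: le_trans (le_poly_height _ m0f) (f_height i).
Qed.

Lemma macaulay_solution : exists w : 'I_s * 'X_{1..n < c.+1} -> L,
  forall m, \sum_x w x * phi (f x.1 * 'X_[x.2])@_m = phi (m == 0%MM)%:R.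
Proof.
pose F i := map_mpoly phi (f i).
have I1 : bounded_ideal (@degree_le L n) (fun p => exists i, p = F i) c 1.
  apply: effective_nullstellensatz => [_ [i ->]|x].
    exact: degree_le_map_mpoly.
  by have [i f_i] := f_nz x; exists (F i) => //; exists i.
have [G G_deg GE] := bounded_ideal_family (fun _ => id) I1.
exists (fun x : 'I_s * 'X_{1..n < c.+1} => (G x.1)@_x.2) => m.
rewrite rmorph_nat -mcoeff1 GE (@mcoeff_sum_mulw _ _ c.+1) => [|i]; last first.
  by rewrite -degree_leE; apply: G_deg.
apply: eq_bigr => x _; congr (_ * _).
by rewrite -mcoeff_map_mpoly rmorphM /= map_mpolyX.
Qed.

Lemma bounded_solution : exists a g,
  is_solution h f c (height_bound theta b (macaulay_level n d))%:R a g.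
Proof.
have [w wE] := macaulay_solution.
pose K : finType := 'X_{1..n < (d + c).+1}.
pose A (x : 'I_s * 'X_{1..n < c.+1}) (m : K) := (f x.1 * 'X_[x.2])@_m.
pose u (m : K) : R := (bmnm m == 0%MM)%:R.
have [||x m|m|a [v [a_nz vE ha hv]]] :=
  linear_solution phi_inj (A := A) (u := u) (w := w) (k := 2).
- by move=> m; rewrite -wE.
- by [].
- exact: height_level_macaulay.
- exact: height_level_natb.
pose g i := \sum_(m : 'X_{1..n < c.+1}) v (i, m) *: 'X_[m] : {mpoly R[n]}.
have g_deg i : degree_le c (g i).
  apply: fil_sum => m _; apply/degree_leZ/filW/degree_leX.
  by rewrite -ltnS bmdeg.
exists a, g; split=> // [|i].
  apply: (@mpolywP _ _ (d + c).+1) => [||m].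
  - by rewrite -degree_leE; apply: degree_leC.
  - by rewrite -degree_leE; apply: fil_sum => i _; apply: degree_leM.
  rewrite (@mcoeff_sum_mulw _ _ c.+1) => [|i]; last first.
    by rewrite -degree_leE; apply: g_deg.
  by rewrite mcoeffC -vE; apply: eq_bigr => -[i m'] _; rewrite mcoeff_sum_bmnm.
apply: poly_height_le => // m /msize_mdeg_lt mg.
have mc : (mdeg m < c.+1)%N.
  by apply: leq_trans mg _; rewrite -degree_leE; apply: g_deg.
have -> : (g i)@_m = v (i, BMultinom mc) := mcoeff_sum_bmnm _ (BMultinom mc).
exact: hv.
Qed.

End BoundedSolution.

End HeightLevels.

(** * Unique factorization and primitive families *)

Section Divisibility.
Variable R : idomainType.
Implicit Types p q x y : R.

Lemma divides_trans x y z : divides x y -> divides y z -> divides x z.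
Proof. by move=> [k ->] [l ->]; exists (l * k); rewrite mulrA. Qed.

Lemma divides_mull x y z : divides x z -> divides x (y * z).
Proof. by move=> [k ->]; exists (y * k); rewrite mulrA. Qed.

Lemma divides0 x : divides x 0.
Proof. by exists 0; rewrite mul0r. Qed.

Lemma divides_prod_mem q (s : seq R) : q \in s -> divides q (\prod_(p <- s) p).
Proof.
by move=> qs; exists (\prod_(p <- rem q s) p); rewrite (big_rem q) //= mulrC.
Qed.

Lemma prime_irreducible p : prime_elt p -> irreducible_elt p.
Proof.
move=> [p0 pU p_prime]; split=> // a b pab.
have /p_prime[[c aE]|[c bE]] : divides p (a * b) by exists 1; rewrite mul1r.
  right; apply/unitrPr; exists c; apply: (mulIf p0).
  by rewrite mul1r -mulrA -aE mulrC.
left; apply/unitrPr; exists c; apply: (mulIf p0).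
by rewrite mul1r -mulrA -bE.
Qed.

Lemma irreducible_unitM u p : u \is a GRing.unit ->
  irreducible_elt p -> irreducible_elt (u * p).
Proof.
move=> uU [p0 pU p_irr]; split.
- by rewrite mulf_neq0 //; apply: contraTneq uU => ->; rewrite unitr0.
- by rewrite unitrMr.
move=> a b uE; have [] := p_irr (u^-1 * a) b; first by rewrite -mulrA -uE mulKr.
  by rewrite unitrMr ?unitrV //; left.
by right.
Qed.

Lemma irreducible_divides p q : irreducible_elt q ->
  p \isn't a GRing.unit -> divides p q -> associated p q.
Proof.
move=> [_ _ q_irr] pU [c cE]; exists c => //.
by case: (q_irr _ _ cE) => // /(negP pU).
Qed.

Lemma prime_divides_associated q p r : prime_elt q -> prime_elt p ->
  prime_elt r -> divides q p -> divides q r -> associated p r.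
Proof.
move=> [_ qU _] /prime_irreducible irr_p /prime_irreducible irr_r qp qr.
have [u uU ->] := irreducible_divides irr_p qU qp.
have [w wU ->] := irreducible_divides irr_r qU qr.
by exists (w * u^-1); rewrite ?unitrM ?unitrV ?wU // -mulrA mulKr.
Qed.

Lemma prime_divides_exprM q p k x :
  prime_elt q -> divides q (p ^+ k * x) -> divides q p \/ divides q x.
Proof.
move=> [_ _ q_prime]; elim: k => [|k IHk]; first by rewrite mul1r; right.
by rewrite exprS -mulrA => /q_prime[|/IHk]; first by left.
Qed.

Lemma prod_irreducible_neq0 (s : seq R) :
  {in s, forall p, irreducible_elt p} -> \prod_(p <- s) p != 0.
Proof.
by move=> irr_s; rewrite prodf_seq_neq0; apply/allP => p /irr_s[].
Qed.

Lemma is_gcd1P (S : R -> Prop) :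
    (forall e, (forall x, S x -> divides e x) -> e \is a GRing.unit) ->
  is_gcd S 1.
Proof.
move=> S_unit; split=> [x _|e /S_unit eU]; first by exists x; rewrite mulr1.
by exists e^-1; rewrite mulVr.
Qed.

End Divisibility.

Section UniqueFactorization.
Variable R : idomainType.
Hypothesis ufd : is_ufd R.
Implicit Types p q x y u : R.
Implicit Types s t : seq R.

Lemma unit_mul_factorization x : x != 0 ->
  exists u s, [/\ u \is a GRing.unit, {in s, forall p, irreducible_elt p} &
    x = u * \prod_(p <- s) p].
Proof.
move=> x0; have [xU|xU] := boolP (x \is a GRing.unit).
  by exists x, [::]; split=> //; rewrite big_nil mulr1.
have [s irr_s xE] := ufd.1 x x0 xU.
by exists 1, s; split=> //; rewrite ?unitr1 // mul1r.
Qed.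

Lemma irreducible_divides_prod p u s : irreducible_elt p ->
    u \is a GRing.unit -> {in s, forall q, irreducible_elt q} ->
    divides p (u * \prod_(q <- s) q) ->
  exists2 q, q \in s & divides p q.
Proof.
move=> irr_p uU irr_s [c cE].
have c_nz : c != 0.
  apply: contra_neq (prod_irreducible_neq0 irr_s) => c0.
  by apply: (mulrI uU); rewrite cE c0 mul0r mulr0.
have [w [t [wU irr_t ct]]] := unit_mul_factorization c_nz.
have [q|q||s' [perm_s' size_s']] := ufd.2 (u^-1 * w * p :: t) s.
- rewrite inE => /predU1P[->|]; last exact: irr_t.
  by apply: irreducible_unitM irr_p; rewrite unitrM unitrV uU.
- exact: irr_s.
- by rewrite big_cons -[RHS](mulKr uU) cE ct; ring.
move=> /(_ 0%N isT)[k kU s'0]; exists s'`_0.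
  by rewrite (perm_mem perm_s') mem_nth // -size_s'.
by rewrite s'0; apply/divides_mull/divides_mull; exists 1; rewrite mul1r.
Qed.

Lemma irreducible_prime p : irreducible_elt p -> prime_elt p.
Proof.
move=> irr_p; have [p_nz pU _] := irr_p; split=> // a b p_ab.
have [->|a_nz] := eqVneq a 0; first by left; apply: divides0.
have [->|b_nz] := eqVneq b 0; first by right; apply: divides0.
have [u [s [uU irr_s aE]]] := unit_mul_factorization a_nz.
have [w [t [wU irr_t bE]]] := unit_mul_factorization b_nz.
have [|q||q] := @irreducible_divides_prod p (u * w) (s ++ t) irr_p.
- by rewrite unitrM uU.
- by rewrite mem_cat => /orP[/irr_s|/irr_t].
- by move: p_ab; rewrite aE bE big_cat mulrACA.
rewrite mem_cat => /orP[] /divides_prod_mem/[swap] pq qs.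
  by left; rewrite aE; apply/divides_mull/divides_trans/qs.
by right; rewrite bE; apply/divides_mull/divides_trans/qs.
Qed.

Lemma factorization_ind (P : R -> Prop) :
    (forall u, u \is a GRing.unit -> P u) ->
    (forall x y, P x -> P y -> P (x * y)) -> (forall p, prime_elt p -> P p) ->
  forall x, x != 0 -> P x.
Proof.
move=> P_unit PM P_prime x /unit_mul_factorization[u [s [uU irr_s ->]]].
apply: (PM); first exact: P_unit.
rewrite big_seq; elim/big_ind: _ => // [|p ps]; first exact/P_unit/unitr1.
exact/P_prime/irreducible_prime/irr_s.
Qed.

Lemma irreducible_divisor x : x != 0 -> x \isn't a GRing.unit ->
  exists2 p, irreducible_elt p & divides p x.
Proof.
move=> x0 xU; have [[|p s] irr_s xE] := ufd.1 x x0 xU.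
  by move: xU; rewrite xE big_nil unitr1.
exists p; first by apply: irr_s; rewrite mem_head.
by rewrite xE; apply: divides_prod_mem; rewrite mem_head.
Qed.

Lemma prime_divisor x : x != 0 -> x \isn't a GRing.unit ->
  exists2 p, prime_elt p & divides p x.
Proof.
by move=> x0 /(irreducible_divisor x0)[p /irreducible_prime]; exists p.
Qed.

Lemma size_nonunits_le u s t : u \is a GRing.unit ->
    {in s, forall p, irreducible_elt p} ->
    {in t, forall q, q \isn't a GRing.unit} ->
    divides (\prod_(q <- t) q) (u * \prod_(p <- s) p) ->
  (size t <= size s)%N.
Proof.
move=> + + + [c]; elim: t u s c => // q t IHt u s c uU irr_s nonU_t.
rewrite big_cons => sE.
have q_nz : q != 0.
  apply: contra_neq (prod_irreducible_neq0 irr_s) => q0.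
  by apply: (mulrI uU); rewrite sE q0 !(mul0r, mulr0).
have [p irr_p [q' qE]] := irreducible_divisor q_nz (nonU_t q (mem_head _ _)).
have [r rs pr] : exists2 r, r \in s & divides p r.
  apply: (irreducible_divides_prod irr_p uU irr_s).
  by exists (c * (q' * \prod_(j <- t) j)); rewrite sE qE; ring.
have [p_nz pU _] := irr_p.
have [k kU rE] := irreducible_divides (irr_s _ rs) pU pr.
have size_s : size s = (size (rem r s)).+1.
  by rewrite size_rem // prednK //; case: (s) rs.
rewrite size_s ltnS; apply: (IHt (u * k) _ (c * q')).
- by rewrite unitrM uU.
- by move=> p' /mem_rem/irr_s.
- by move=> q'' q''t; apply: nonU_t; rewrite inE q''t orbT.
apply: (mulIf p_nz); rewrite [RHS](_ : _ = c * (q * \prod_(j <- t) j)).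
  by rewrite -sE (big_rem r rs) /= rE; ring.
by rewrite qE; ring.
Qed.

(* The gcd of [S] is a product of nonunits of maximal length dividing [S]. *)
Lemma exists_content (S : R -> Prop) x : x != 0 -> S x ->
  exists d, [/\ d != 0, forall y, S y -> divides d y &
    forall e, (forall y, S y -> divides (e * d) y) -> e \is a GRing.unit].
Proof.
move=> x_nz Sx; have [u [s [uU irr_s xE]]] := unit_mul_factorization x_nz.
pose P k := `[< exists t, [/\ size t = k,
  {in t, forall q, q \isn't a GRing.unit} &
  forall y, S y -> divides (\prod_(q <- t) q) y] >].
have P0 : P 0%N.
  apply/asboolP; exists [::]; split=> // y _.
  by rewrite big_nil; exists y; rewrite mulr1.
have P_le k : P k -> (k <= size s)%N.
  move=> /asboolP[t [<- nonU_t tS]]; apply: (size_nonunits_le uU irr_s nonU_t).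
  by rewrite -xE; apply: tS.
case: (ex_maxnP (ex_intro P 0%N P0) P_le) => k.
move=> /asboolP[t [size_t nonU_t tS]] k_max.
exists (\prod_(q <- t) q); split=> // [|e eS].
  by apply: contra_neq x_nz => t0; have [c ->] := tS x Sx; rewrite t0 mulr0.
apply: contraT => eU; have : (k.+1 <= k)%N; last by rewrite ltnn.
apply: k_max; apply/asboolP; exists (e :: t); split=> [/=|q|y].
- by rewrite size_t.
- by rewrite inE => /predU1P[->|/nonU_t].
- by rewrite big_cons; apply: eS.
Qed.

End UniqueFactorization.

Definition primitive (R : idomainType) n (I : Type)
    (f : I -> {mpoly R[n]}) : Prop :=
  forall e, (forall i m, divides e (f i)@_m) -> e \is a GRing.unit.

Section ShiftedSum.
Variables (R : idomainType) (n : nat) (M : 'X_{1..n}) (p q : {mpoly R[n]}).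
Hypothesis pM : (msize p <= mdeg M)%N.

Lemma mcoeff_shiftD_low m : (mdeg m < mdeg M)%N -> (p + q * 'X_[M])@_m = p@_m.
Proof.
move=> mM; rewrite mcoeffD [X in _ + X]memN_msupp_eq0 ?addr0 //.
rewrite (perm_mem (msuppMX _ _)); apply/negP => /mapP[m' _ mE].
by move: mM; rewrite mE mdegD ltnNge leq_addr.
Qed.

Lemma mcoeff_shiftD_high m : (p + q * 'X_[M])@_(M + m) = q@_m.
Proof.
rewrite mcoeffD mcoeffMX memN_msupp_eq0 ?add0r // msize_mdeg_ge // mdegD.
exact: leq_trans pM (leq_addr _ _).
Qed.

Lemma msupp_shiftD m : m \in msupp (p + q * 'X_[M]) ->
  m \in msupp p \/ exists2 m', m' \in msupp q & m = (M + m')%MM.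
Proof.
move=> /msuppD_le; rewrite mem_cat => /orP[|]; first by left.
by rewrite (perm_mem (msuppMX _ _)) => /mapP[m' m'q ->]; right; exists m'.
Qed.

End ShiftedSum.

Section PrimitiveFamilies.
Variable R : idomainType.
Hypothesis ufd : is_ufd R.
Variable n : nat.

Lemma divides_mpolyP d (p : {mpoly R[n]}) :
  (forall m, divides d p@_m) -> exists q, p = d *: q.
Proof.
move=> /choice[y yE]; exists (\sum_(m <- msupp p) y m *: 'X_[m]).
rewrite {1}[p]mpolyE scaler_sumr; apply: eq_bigr => m _.
by rewrite scalerA mulrC -yE.
Qed.

Lemma exists_primitive_part (I : Type) (f : I -> {mpoly R[n]}) i :
    f i != 0 ->
  exists d f', [/\ d != 0, forall j, f j = d *: f' j & primitive f'].
Proof.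
move=> f_nz; have lead_nz : (f i)@_(mlead (f i)) != 0 by rewrite mleadc_eq0.
have [|d [d_nz d_f d_max]] :=
  exists_content ufd (S := fun x => exists j m, x = (f j)@_m) lead_nz.
  by exists i, (mlead (f i)).
have /choice[f' fE] : forall j, exists q, f j = d *: q.
  by move=> j; apply: divides_mpolyP => m; apply: d_f; exists j, m.
exists d, f'; split=> // e e_f'; apply: d_max => _ [j [m ->]].
have [y yE] := e_f' j m; exists y.
by rewrite fE mcoeffZ yE mulrCA [d * e]mulrC.
Qed.

Lemma prime_divides_primitive (I : Type) (f : I -> {mpoly R[n]}) q p k :
    primitive f -> prime_elt q -> (forall i m, divides q (p ^+ k *: f i)@_m) ->
  divides q p.
Proof.
move=> prim_f q_prime q_f; apply: contrapT => q_p.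
have [_ /negP qU _] := q_prime; apply/qU/prim_f => i m.
by have := q_f i m; rewrite mcoeffZ => /(prime_divides_exprM q_prime)[].
Qed.

(* A common prime divisor of all coefficients would divide both [p], because of
   the low degrees, and [r], because of the high ones. *)
Lemma primitive_shiftD (I : Type) (f g : I -> {mpoly R[n]}) M p r k l :
    prime_elt p -> prime_elt r -> ~ associated p r ->
    primitive f -> primitive g -> (forall i, msize (f i) <= mdeg M)%N ->
  primitive (fun i => p ^+ k *: f i + (r ^+ l *: g i) * 'X_[M]).
Proof.
move=> p_prime r_prime not_pr prim_f prim_g fM.
have pfM i : (msize (p ^+ k *: f i) <= mdeg M)%N.
  exact: leq_trans (msizeZ_le _ _) (fM i).
have no_prime q : prime_elt q ->
    ~ forall i m, divides q (p ^+ k *: f i + (r ^+ l *: g i) * 'X_[M])@_m.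
  move=> q_prime q_fg; apply: not_pr.
  apply: (prime_divides_associated q_prime) => //.
    apply: (prime_divides_primitive (k := k) prim_f q_prime) => i m.
    have [mM|mM] := ltnP (mdeg m) (mdeg M).
      by have := q_fg i m; rewrite mcoeff_shiftD_low.
    rewrite memN_msupp_eq0; first exact: divides0.
    by rewrite msize_mdeg_ge // (leq_trans (pfM i)).
  apply: (prime_divides_primitive (k := l) prim_g q_prime) => i m.
  by have := q_fg i (M + m)%MM; rewrite mcoeff_shiftD_high.
move=> e e_fg; apply: contraT => eU.
have [e0|e_nz] := eqVneq e 0.
  case: (no_prime p p_prime) => i m; have [y ->] := e_fg i m.
  by rewrite e0 mulr0; apply: divides0.
have [q q_prime qe] := prime_divisor ufd e_nz eU.
by case: (no_prime q q_prime) => i m; apply: divides_trans qe (e_fg i m).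
Qed.

End PrimitiveFamilies.

(** * Absolute values *)

Lemma bernoulli (K : realDomainType) (x : K) k :
  0 <= x -> 1 + k%:R * x <= (1 + x) ^+ k.
Proof.
move=> x_ge0; elim: k => [|k IHk]; first by rewrite mul0r addr0.
rewrite exprSr; apply: le_trans (ler_wpM2r _ IHk); last by rewrite addr_ge0.
rewrite -subr_ge0 -natr1.
have -> : (1 + k%:R * x) * (1 + x) - (1 + (k%:R + 1) * x) = k%:R * x ^+ 2.
  by ring.
by rewrite mulr_ge0 // sqr_ge0.
Qed.

Lemma exists_exprn_mul_le1 (K : archiRealFieldType) (x C : K) :
    0 <= x -> x < 1 ->
  exists k, x ^+ k * C <= 1.
Proof.
move=> x_ge0 x_lt1; have [C_le0|C_gt0] := leP C 0.
  by exists 0%N; rewrite expr0 mul1r (le_trans C_le0).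
have [->|x_nz] := eqVneq x 0; first by exists 1%N; rewrite mul0r.
have x_gt0 : 0 < x by rewrite lt_def x_nz.
pose y := x^-1 - 1; have y_gt0 : 0 < y by rewrite subr_gt0 invf_gt1.
exists (Num.bound (C / y)).
have := archi_boundP (divr_ge0 (ltW C_gt0) (ltW y_gt0)).
rewrite ltr_pdivrMr // => Ck.
rewrite mulrC -ler_pdivlMr ?exprn_gt0 // mul1r -exprVn -[x^-1](subrKC 1).
apply: le_trans (bernoulli _ (ltW y_gt0)).
by rewrite (le_trans (ltW Ck)) // lerDr.
Qed.

Section AbsoluteValue.
Variables (RR : realType) (R : idomainType) (v : R -> RR).
Hypothesis v_abs : is_absolute_value v.

Lemma absv_ge0 x : 0 <= v x. Proof. by case: v_abs. Qed.

Lemma absv0 : v 0 = 0. Proof. by case: v_abs => _ /(_ 0)[_ ->]. Qed.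

Lemma absvM : {morph v : x y / x * y}. Proof. by case: v_abs. Qed.

Lemma absv_gt0 x : x != 0 -> 0 < v x.
Proof.
move=> x_nz; rewrite lt_def absv_ge0 andbT; apply: contra_neq x_nz.
by case: v_abs => _ /(_ x)[].
Qed.

Lemma absv1 : v 1 = 1.
Proof.
apply: (mulfI (lt0r_neq0 (absv_gt0 (oner_neq0 R)))).
by rewrite -absvM !mulr1.
Qed.

Lemma absvX k : {morph v : x / x ^+ k}.
Proof.
by move=> x; elim: k => [|k IHk]; rewrite ?absv1 // !exprS absvM IHk.
Qed.

Variable n : nat.
Implicit Types p q : {mpoly R[n]}.

Lemma poly_height_ge0 p : 0 <= poly_height v p.
Proof. exact: bigmax_ge_id. Qed.

Lemma poly_heightC (x : R) : poly_height v (x%:MP : {mpoly R[n]}) = v x.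
Proof.
rewrite /poly_height msuppC; case: eqP => [->|_].
  by rewrite big_nil absv0.
by rewrite big_cons big_nil mcoeffC eqxx mulr1 max_l ?absv_ge0.
Qed.

Lemma poly_heightZ x p : poly_height v (x *: p) = v x * poly_height v p.
Proof.
have [->|x_nz] := eqVneq x 0.
  by rewrite scale0r absv0 mul0r /poly_height msupp0 big_nil.
rewrite /poly_height (perm_big _ (msuppZ p x_nz)) /=.
rewrite (big_morph _ (fun y z => maxr_pMr y z (absv_ge0 x)) (mulr0 _)).
by apply: eq_bigr => m _; rewrite mcoeffZ absvM.
Qed.

Lemma poly_height_shiftD C p q M : (msize p <= mdeg M)%N ->
    poly_height v p <= C -> poly_height v q <= C ->
  poly_height v (p + q * 'X_[M]) <= C.
Proof.
move=> pM pC qC; apply: poly_height_le => [|m /msupp_shiftD[mp|[m' m'q ->]]].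
- exact: le_trans (poly_height_ge0 p) pC.
- rewrite mcoeff_shiftD_low; last exact: leq_trans (msize_mdeg_lt mp) pM.
  exact: le_trans (le_poly_height _ mp) pC.
rewrite mcoeff_shiftD_high //.
exact: le_trans (le_poly_height _ m'q) qC.
Qed.

Lemma exists_small_multiple (I : finType) (f : I -> {mpoly R[n]}) x : v x < 1 ->
  exists k, forall i, poly_height v (x ^+ k *: f i) <= 1.
Proof.
move=> x_lt1; have [k xk] :=
  exists_exprn_mul_le1 (\sum_i poly_height v (f i)) (absv_ge0 x) x_lt1.
exists k => i; rewrite poly_heightZ absvX; apply: le_trans xk.
rewrite ler_wpM2l ?exprn_ge0 ?absv_ge0 // (bigD1 i) //= lerDl.
by apply: sumr_ge0 => j _; apply: poly_height_ge0.
Qed.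

End AbsoluteValue.

(** * Coprime solutions *)

Definition solution_family (R : idomainType) n s (a : R)
    (g : 'I_s -> {mpoly R[n]}) (o : option 'I_s) : {mpoly R[n]} :=
  if o is Some i then g i else a%:MP.

Section CoprimeSolution.
Variables (RR : realType) (R : idomainType) (v : R -> RR).
Hypothesis v_prop : ufd_with_p_property v.

Let ufd : is_ufd R. Proof. by case: v_prop. Qed.
Let v_abs : is_absolute_value v. Proof. by case: v_prop. Qed.
Let v_unit u : u \is a GRing.unit -> v u = 1.
Proof. by case: v_prop => _ _ + _; apply. Qed.

Lemma absv_ge1_of_primes : (forall p, prime_elt p -> 1 <= v p) ->
  forall x, x != 0 -> 1 <= v x.
Proof.
move=> v_prime; apply: (factorization_ind ufd) => // [u /v_unit->//|x y].
by rewrite absvM //; apply: mulr_ege1.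
Qed.

Lemma absv_le1_of_primes : (forall p, prime_elt p -> v p <= 1) ->
  forall x, v x <= 1.
Proof.
move=> v_prime x; have [->|] := eqVneq x 0; first by rewrite absv0.
move: x; apply: (factorization_ind ufd) => // [u /v_unit->//|x y].
by rewrite absvM // => x_le1 y_le1; rewrite mulr_ile1 ?absv_ge0.
Qed.

Lemma absv_trichotomy : [\/ forall x, x != 0 -> 1 <= v x, forall x, v x <= 1 |
  exists p r,
    [/\ prime_elt p, prime_elt r, ~ associated p r, v p < 1 & v r < 1]].
Proof.
have [v_ge1|/existsNP[p /not_implyP[p_prime /negP]]] :=
  pselect (forall p, prime_elt p -> 1 <= v p).
  by constructor 1; apply: absv_ge1_of_primes.
rewrite -ltNge => p_lt1.
have [v_le1|/existsNP[q /not_implyP[q_prime /negP]]] :=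
  pselect (forall p, prime_elt p -> v p <= 1).
  by constructor 2; apply: absv_le1_of_primes.
rewrite -ltNge => q_gt1; constructor 3; have [_ _ _ p_property] := v_prop.
have [r [r_prime not_pr r_lt1]] := p_property p q p_prime q_prime p_lt1 q_gt1.
by exists p, r.
Qed.

Variables (n s : nat) (f : 'I_s -> {mpoly R[n]}).

Lemma primitive_solution c C a g : is_solution v f c C a g ->
  exists C' a' g', [/\ is_solution v f c C' a' g',
    primitive (solution_family a' g') &
    (forall x, x != 0 -> 1 <= v x) -> C' <= C].
Proof.
move=> [a_nz agE g_deg a_C g_C].
have a_nz' : solution_family a g None != 0 by rewrite mpolyC_eq0.
have [d [w [d_nz dw prim_w]]] := exists_primitive_part ufd a_nz'.
have aE : a = d * (w None)@_0.
  by have /(congr1 (mcoeff 0)) := dw None; rewrite mcoeffC eqxx mulr1 mcoeffZ.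
have w_None : w None = ((w None)@_0)%:MP.
  by apply: msize1_polyC; rewrite -(msizeZ _ d_nz) -dw /= msizeC; case: eqP.
have gE i : g i = d *: w (Some i) := dw (Some i).
have d_gt0 := absv_gt0 v_abs d_nz.
exists (C / v d), (w None)@_0, (fun i => w (Some i)); split.
- split.
  + by apply: contraNneq a_nz => w0; rewrite aE w0 mulr0.
  + apply/mpolyP => m; apply: (mulfI d_nz).
    rewrite -w_None -!mcoeffZ -dw /= agE scaler_sumr; congr (_ @_ m).
    by apply: eq_bigr => i _; rewrite gE scalerAr.
  + by move=> i; rewrite degree_leE -(msizeZ _ d_nz) -gE -degree_leE.
  + by rewrite ler_pdivlMr // mulrC -absvM // -aE.
  + by move=> i; rewrite ler_pdivlMr // mulrC -poly_heightZ // -gE.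
- move=> e e_w; apply: prim_w => -[i|] m; first exact: (e_w (Some i)).
  by rewrite w_None; apply: (e_w None).
move=> v_ge1; rewrite ler_pdivrMr // ler_peMr ?v_ge1 //.
exact: le_trans (absv_ge0 v_abs a) a_C.
Qed.

Lemma exists_primitive_syzygy D i j : (forall k, degree_le D (f k)) ->
    j != i -> f i != 0 ->
  exists t,
    [/\ \sum_k f k * t k = 0, forall k, degree_le D (t k) & primitive t].
Proof.
move=> f_deg ji f_nz.
pose koszul k := if k == j then f i else if k == i then - f j else 0.
have koszul_deg k : degree_le D (koszul k).
  rewrite /koszul; case: eqP => // _; case: eqP => _; last exact: fil0.
  exact: degree_leN.
have koszulE : \sum_k f k * koszul k = 0.
  rewrite (bigD1 j) // (bigD1 i) 1?eq_sym //= big1 => [|k].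
    by rewrite /koszul eqxx eq_sym (negPf ji) eqxx mulrN addr0 mulrC subrr.
  by move=> /andP[/negPf kj /negPf ki]; rewrite /koszul kj ki mulr0.
have koszul_nz : koszul j != 0 by rewrite /koszul eqxx.
have [d [t [d_nz dt prim_t]]] := exists_primitive_part ufd koszul_nz.
exists t; split=> // [|k]; last first.
  by rewrite degree_leE -(msizeZ _ d_nz) -dt -degree_leE.
apply/eqP; have : d *: \sum_k f k * t k == 0.
  apply/eqP; rewrite scaler_sumr -[RHS]koszulE.
  by apply: eq_bigr => k _; rewrite dt scalerAr.
by rewrite -mul_mpolyC mulf_eq0 mpolyC_eq0 (negPf d_nz).
Qed.

Lemma shifted_solution c D C a g t p r : (0 < n)%N ->
    is_solution v f c C a g -> primitive (solution_family a g) ->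
    \sum_k f k * t k = 0 -> (forall k, degree_le D (t k)) -> primitive t ->
    prime_elt p -> prime_elt r -> ~ associated p r -> v p < 1 -> v r < 1 ->
  exists a' g', is_solution v f (c + D + 1) 1 a' g' /\
    primitive (solution_family a' g').
Proof.
move=> n_gt0 [a_nz agE g_deg _ _] prim_g tE t_deg prim_t.
move=> p_prime r_prime not_pr p_lt1 r_lt1.
have [k pk] := exists_small_multiple v_abs (solution_family a g) p_lt1.
have [l rl] := exists_small_multiple v_abs t r_lt1.
pose M : 'X_{1..n} := (U_(Ordinal n_gt0) *+ c.+1)%MM.
have degM : mdeg M = c.+1 by rewrite mdegMn mdeg1 mul1n.
have gM o : (msize (solution_family a g o) <= mdeg M)%N.
  rewrite degM -degree_leE.
  by case: o => [i|]; [apply: g_deg | apply: degree_leC].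
exists (p ^+ k * a), (fun i => p ^+ k *: g i + (r ^+ l *: t i) * 'X_[M]).
split; last first.
  pose t' o := if o is Some i then t i else 0.
  have prim_t' : primitive t'.
    by move=> e e_t; apply: prim_t => i; apply: (e_t (Some i)).
  have prim_gt := primitive_shiftD ufd (k := k) (l := l) p_prime r_prime
    not_pr prim_g prim_t' gM.
  move=> e e_g; apply: prim_gt => -[i|] m; first exact: (e_g (Some i)).
  by have := e_g None m; rewrite /= scaler0 mul0r addr0 mpolyCM mul_mpolyC.
split.
- by rewrite mulf_neq0 // expf_neq0 //; case: p_prime.
- under eq_bigr do rewrite mulrDr mulrA -!scalerAr.
  rewrite big_split /= -scaler_sumr -agE -mulr_suml -scaler_sumr tE scaler0.
  by rewrite mul0r addr0 mpolyCM mul_mpolyC.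
- move=> i; apply: filD; first by apply/filW/degree_leZ/g_deg; lia.
  have -> : (c + D + 1 = D + c.+1)%N by lia.
  by apply: filM; [apply: degree_leZ | rewrite -degM; apply: degree_leX].
- by have := pk None; rewrite -mul_mpolyC -mpolyCM poly_heightC.
move=> i; apply: poly_height_shiftD => //; last exact: (pk (Some i)).
exact: leq_trans (msizeZ_le _ _) (gM (Some i)).
Qed.

Lemma single_solution c C a g i : is_solution v f c C a g ->
    (forall j, j = i) -> poly_height v (f i) <= C -> 1 <= C ->
  exists2 a', is_solution v f 0 C a' (fun=> 1) &
    primitive (solution_family a' (fun=> 1 : {mpoly R[n]}) : option 'I_s -> _).
Proof.
move=> [a_nz + _ _ _] all_i f_C C_ge1.
have sum_i (F : 'I_s -> {mpoly R[n]}) : \sum_j F j = F i.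
  by rewrite (bigD1 i) //= big1 ?addr0 // => j; rewrite (all_i j) eqxx.
rewrite sum_i => agE.
have [a' a'_nz fE] : exists2 a', a' != 0 & f i = a'%:MP.
  apply/msize_poly1P; have /andP[f_nz g_nz] : (f i != 0) && (g i != 0).
    by rewrite -negb_or -mulf_eq0 -agE mpolyC_eq0.
  have := congr1 (fun p : {mpoly R[n]} => msize p) agE.
  rewrite msizeC a_nz msizeM // => size_fg.
  by move: f_nz g_nz; rewrite -!msize_poly_eq0; lia.
exists a'; last first.
  move=> e /(_ (Some i) 0%MM)[y]; rewrite /= mcoeff1 eqxx => ye.
  by apply/unitrPr; exists y; rewrite mulrC.
split=> // [|j||j].
- by rewrite sum_i mulr1.
- exact: degree_leC.
- by move: f_C; rewrite fE poly_heightC.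
- by rewrite poly_heightC // absv1.
Qed.

Lemma coprime_solution c D C a g : (0 < n)%N -> 1 <= C ->
    (forall i, degree_le D (f i)) -> (forall i, poly_height v (f i) <= C) ->
    is_solution v f c C a g ->
  exists a' g', is_solution v f (c + D + 1) C a' g' /\
    primitive (solution_family a' g').
Proof.
move=> n_gt0 C_ge1 f_deg f_C sol; have [a_nz agE _ _ _] := sol.
have [i f_nz] : exists i, f i != 0.
  apply: contrapT => f0; move: a_nz.
  rewrite -(mpolyC_eq0 n) agE big1 ?eqxx // => i _.
  by have /eqP-> : f i == 0; [apply: contra_notT f0; exists i | rewrite mul0r].
have [[j ji]|no_j] := pselect (exists j, j != i); last first.
  have all_i j : j = i by apply/eqP/negPn/negP => ji; apply: no_j; exists j.
  have [a' sol' prim'] := single_solution sol all_i (f_C i) C_ge1.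
  by exists a', (fun=> 1); split=> //; apply: is_solutionW sol'.
have [C' [a' [g' [sol' prim' C'_le]]]] := primitive_solution sol.
have c_le : (c <= c + D + 1)%N by lia.
have [v_ge1|v_le1|[p [r]]] := absv_trichotomy.
- by exists a', g'; split=> //; apply: is_solutionW sol' => //; apply: C'_le.
- have [a'_nz agE' g'_deg _ _] := sol'; exists a', g'; split=> //.
  apply: (@is_solutionW _ _ _ _ _ _ _ c _ 1) => //; split=> // k.
  by apply: poly_height_le.
move=> [p_prime r_prime not_pr p_lt1 r_lt1].
have [t [tE t_deg prim_t]] := exists_primitive_syzygy f_deg ji f_nz.
have [a'' [g'' [sol'' prim'']]] := shifted_solution n_gt0 sol' prim' tE t_deg
  prim_t p_prime r_prime not_pr p_lt1 r_lt1.
by exists a'', g''; split=> //; apply: is_solutionW sol''.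
Qed.

End CoprimeSolution.

Lemma is_gcd_solution_family (R : idomainType) n s (a : R)
    (g : 'I_s -> {mpoly R[n]}) : primitive (solution_family a g) ->
  is_gcd (fun x => x = a \/ exists i m, m \in msupp (g i) /\ x = (g i)@_m) 1.
Proof.
move=> prim_g; apply: is_gcd1P => e e_div; apply: prim_g => -[i|] m /=.
  have [mg|/memN_msupp_eq0->] := boolP (m \in msupp (g i)); last first.
    exact: divides0.
  by apply: e_div; right; exists i, m.
by rewrite mcoeffC mulrC; apply/divides_mull/e_div; left.
Qed.

Section FractionEmbedding.
Variables (R : idomainType) (L : closedFieldType).
Variable iota : {rmorphism {fraction R} -> L}.

Lemma inj_comp_tofrac : injective (iota \o @tofrac R).
Proof. by move=> x y /fmorph_inj/eqP; rewrite tofrac_eq => /eqP. Qed.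

Lemma no_common_zero_neq0 n s (f : 'I_s -> {mpoly R[n]}) :
    ~ (exists z, common_zero iota f z) ->
  forall x, exists i, (map_mpoly (iota \o @tofrac R) (f i)).@[x] != 0.
Proof.
move=> no_zero x; apply: contrapT => no_i; apply: no_zero; exists x => i.
by apply/eqP; apply: contra_notT no_i; exists i.
Qed.

End FractionEmbedding.

(* The argument [h (-1)] of [c2] cannot be dropped: nothing in the definition
   of theta-type bounds the height of [- x].  On the integers, let
   h x = x for x >= 0 and h x = M + |x| for x < 0; this is of theta-type for
   theta k = k ^ 2 + 3 * k whatever M is.  For f1 = X and f2 = X + 1, both of
   height 1, elements of height at most M are nonnegative, and
   X * h1 + (X + 1) * h2 is never a nonzero constant when h1 and h2 have
   nonnegative coefficients.  For an absolute value h (-1) = 1. *)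
Theorem theoremA (RR : realType) :
  exists (c1 : nat -> nat -> nat)
         (c2 : nat -> nat -> nat -> (nat -> nat) -> RR -> RR),
  forall (R : idomainType) (theta : nat -> nat) (h : R -> RR),
    height_of_type theta h ->
  forall (L : closedFieldType) (iota : {rmorphism {fraction R} -> L}),
    is_algebraic_closure iota ->
  forall n D H : nat, (1 <= n)%N -> (1 <= D)%N -> (1 <= H)%N ->
  forall (s : nat) (f : 'I_s -> {mpoly R[n]}),
    ~ (exists z : 'I_n -> L, common_zero iota f z) ->
    (forall i, (total_degree (f i) <= D)%N) ->
    (forall i, poly_height h (f i) <= H%:R) ->
  exists (a : R) (g : 'I_s -> {mpoly R[n]}),
    [/\ a != 0,
        a%:MP = \sum_(i < s) f i * g i,
        forall i, (total_degree (g i) <= c1 n D)%N,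
        h a <= c2 n D H theta (h (-1)) /\
          (forall i, poly_height h (g i) <= c2 n D H theta (h (-1))) &
        ufd_with_p_property h ->
          is_gcd (fun x => x = a \/
                    exists i m, m \in msupp (g i) /\ x = (g i)@_m) 1].
Proof.
exists (fun n D => nullstellensatz_degree n D + D + 1)%N.
exists (fun n D H theta x =>
  (height_bound theta (maxn H (Num.bound x)) (macaulay_level n D))%:R).
move=> R theta h h_type L iota _ n D H n_gt0 _ H_gt0 s f no_zero f_deg f_height.
set b := maxn H _; set C := _%:R.
have hN1 : h (-1) <= b%:R.
  by rewrite (le_trans (ltW (archi_boundP (h_type.1 _)))) // ler_nat leq_maxr.
have f_b i : poly_height h (f i) <= b%:R.
  by rewrite (le_trans (f_height i)) // ler_nat leq_maxl.
have b_C : b%:R <= C by rewrite ler_nat (@leq_height_bound theta b 0).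
have C_ge1 : 1 <= C by rewrite (le_trans _ b_C) // ler1n leq_max H_gt0.
have [a [g sol]] := bounded_solution h_type hN1 (@inj_comp_tofrac _ _ iota)
  f_deg f_b (no_common_zero_neq0 no_zero).
have [v_prop|no_prop] := pselect (ufd_with_p_property h); last first.
  have [a_nz agE g_deg a_C g_C] := sol; exists a, g; split=> // i.
  by apply: leq_trans (g_deg i) _; rewrite -addnA leq_addr.
have f_C i := le_trans (f_b i) b_C.
have [a' [g' [[]]]] := coprime_solution v_prop n_gt0 C_ge1 f_deg f_C sol.
by exists a', g'; split=> // _; apply: is_gcd_solution_family.
Qed.
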